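(* Let $\mathbb{F}$ be an algebraically closed field. Let $Z=\mathrm{Z}(X)\subseteq Y\subseteq X\unlhd G$ be finite groups, and let $\nu\in\mathrm{IBr}(Z)$, $\chi\in\mathrm{IBr}(X\mid\nu)$, $\psi\in\mathrm{IBr}(Y\mid\nu)$. Denote $X'=[X,X]$, $Y'=Y\cap X'$, $Z'=Z\cap X'$. Assume the following hypotheses: (i) $X=X'Z$ (so that $X'$ is perfect with center $Z'$) and $Z\subseteq \mathrm{Z}(G)$. (ii) $\mathrm{N}_X(Y)_\psi=Y$, $\mathrm{N}_G(Y)_\chi=\mathrm{N}_G(Y)_\psi$ and $G_\chi=X\cdot\mathrm{N}_G(Y)_\psi$ (so that $\mathrm{N}_G(Y)_\psi/Y\cong G_\chi/X$ by the natural map). (iii) $\mathrm{Res}^X_{X'}\chi$ and $\mathrm{Res}^Y_{Y'}\psi$ satisfy the cohomological condition with respect to $X'\supseteq Y'\supseteq Z'$. Then the modular character triples $(G_\chi,X,\chi)$ and $(\mathrm{N}_G(Y)_\psi,Y,\psi)$ are isomorphic. In particular $$|\mathrm{IBr}(G\mid\chi)|=|\mathrm{IBr}(\mathrm{N}_G(Y)\mid\psi)|.$$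
   Context: For a finite group $G$, $\mathrm{IBr}(G)$ is the set of isomorphism classes of irreducible $\mathbb{F}$-linear representations of $G$ (equivalently of simple $\mathbb{F}G$-modules); a representation ''affords'' its class. If $H$ is a subgroup of $G$ and $\zeta\in\mathrm{IBr}(H)$, $\mathrm{IBr}(G\mid\zeta)$ is the set of classes of simple $\mathbb{F}G$-modules whose restriction to $\mathbb{F}H$ contains a submodule in the class $\zeta$. Groups act on representations by conjugation and, for automorphisms, ${}^\tau\mathcal{P}=\mathcal{P}\circ\tau^{-1}$; subscripts denote (simultaneous) stabilizers: e.g. $G_\chi$ is the stabilizer of $\chi$ in $G$, $\mathrm{N}_G(Y)_\psi$ the stabilizer of $\psi$ in $\mathrm{N}_G(Y)$, $\mathrm{Aut}(X)_{Y,\psi}$ the group of automorphisms of $X$ stabilizing $Y$ and $\psi$, and $\mathrm{Aut}(X)_{Y,\psi,\chi}=\mathrm{Aut}(X)_{Y,\psi}\cap \mathrm{Aut}(X)_\chi$. A (normalized) projective representation of a group $G$ is a map $\mathcal{P}\colon G\to\mathrm{GL}_n(\mathbb{F})$ with $\mathcal{P}(1)=\mathrm{Id}_n$ such that $\mathcal{P}(g)\mathcal{P}(g')=\alpha_{\mathcal{P}}(g,g')\mathcal{P}(gg')$ for all $g,g'$, for some (unique) cocycle $\alpha_{\mathcal{P}}\in \mathrm{Z}^2(G,\mathbb{F}^\times)$. Cohomological condition: given finite groups $X\supseteq Y\supseteq Z=\mathrm{Z}(X)$ and $(\chi,\psi)\in\mathrm{IBr}(X)\times\mathrm{IBr}(Y)$,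 the pair $(\chi,\psi)$ satisfies it (with respect to $X\supseteq Y\supseteq Z$) if there are (normalized) projective representations $\mathcal{P}$ of $\mathrm{Aut}(X)_\chi$ and $\mathcal{Q}$ of $\mathrm{Aut}(X)_{Y,\psi}$ such that, identifying $X/Z$ with the subgroup of inner automorphisms in $\mathrm{Aut}(X)$: (i) the restriction of $\mathcal{P}$ to $X/Z$ is $\mathcal{L}\circ\mathbf{s}$, where $\mathbf{s}\colon X/Z\to X$ is a section of the quotient map $X\to X/Z$ with $\mathbf{s}(1)=1$, and $\mathcal{L}$ is a linear representation of $X$ affording $\chi$; (i') the restriction of $\mathcal{Q}$ to $Y/Z$ is $\mathcal{M}\circ\mathbf{t}$, where $\mathbf{t}\colon Y/Z\to Y$ is the restriction of $\mathbf{s}$, and $\mathcal{M}$ is a linear representation of $Y$ affording $\psi$; (ii) the restrictions of $\mathcal{P}$ and $\mathcal{Q}$ to $\mathrm{Aut}(X)_{Y,\psi,\chi}$ have the same cocycle in $\mathrm{Z}^2(\mathrm{Aut}(X)_{Y,\psi,\chi},\mathbb{F}^\times)$. Modular character triples: a modular character triple $(G,N,\theta)$ consists of a finite group $G$, $N\unlhd G$ and a $G$-invariant $\theta\in\mathrm{IBr}(N)$. For $N\subseteq H\subseteq G$ let $R(H\mid\theta)$ be the subgroup of the Grothendieck group of finite-dimensional $\mathbb{F}H$-modules freely generated by $\mathrm{IBr}(H\mid\theta)$. Two triples $(G,N,\theta)$ and $(\Gamma,M,\varphi)$ are isomorphic (Navarro, ''Characters and Blocks of Finite Groups'', Definition 8.25)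 if there is a group isomorphism $\tau\colon G/N\to\Gamma/M$ and, writing $H^\tau$ for the subgroup of $\Gamma$ containing $M$ with $H^\tau/M=\tau(H/N)$, for every subgroup $N\subseteq H\subseteq G$ a bijection $\sigma_H\colon\mathrm{IBr}(H\mid\theta)\to\mathrm{IBr}(H^\tau\mid\varphi)$, extended additively to $R(H\mid\theta)\to R(H^\tau\mid\varphi)$, such that for all $N\subseteq K\subseteq H\subseteq G$ and $\eta\in R(H\mid\theta)$: $\sigma_K(\mathrm{Res}^H_K\eta)=\mathrm{Res}^{H^\tau}_{K^\tau}\sigma_H(\eta)$, and $\sigma_H(\eta\beta)=\sigma_H(\eta)\beta^\tau$ for every $\beta\in\mathrm{IBr}(H/N)$, where $\beta^\tau\in\mathrm{IBr}(H^\tau/M)$ corresponds to $\beta$ through $\tau$ and the product is induced by the tensor product of modules. *)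

(* Defs.v *)
From HB Require Import structures.
From mathcomp Require Import all_boot all_order all_algebra all_fingroup.
From mathcomp Require Import all_solvable all_field all_character.
From mathcomp Require Import boolp.

Set Implicit Arguments.
Unset Strict Implicit.
Unset Printing Implicit Defensive.

Import GroupScope GRing.Theory.

Section IrreducibleBrauer.

Variables (F : closedFieldType) (gT : finGroupType) (G : {group gT}).

Record irrRepr := IrrRepr {
  irr_degree : nat;
  irr_repr_of :> mx_representation F G irr_degree;
  irr_reprP : mx_irreducible irr_repr_of
}.

HB.instance Definition _ := gen_eqMixin irrRepr.
HB.instance Definition _ := gen_choiceMixin irrRepr.

Definition irr_sim (V W : irrRepr) : bool := `[< mx_rsim V W >].

Lemma irr_sim_refl : reflexive irr_sim.
Proof. by move=> V; apply/asboolP; apply: mx_rsim_refl. Qed.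

Lemma irr_sim_sym : symmetric irr_sim.
Proof. by move=> V W; apply/asboolP/asboolP; apply: mx_rsim_sym. Qed.

Lemma irr_sim_trans : transitive irr_sim.
Proof.
move=> V U W /asboolP UV /asboolP VW; apply/asboolP.
exact: mx_rsim_trans UV VW.
Qed.

Canonical irr_sim_equiv := EquivRel irr_sim irr_sim_refl irr_sim_sym irr_sim_trans.

Local Open Scope quotient_scope.

Definition IBr := {eq_quot irr_sim}.
HB.instance Definition _ := EqQuotient.on IBr.

Definition irrep (i : IBr) : irrRepr := generic_quotient.repr i.

Definition affords n (rG : mx_representation F G n) (i : IBr) : Prop :=
  mx_rsim rG (irrep i).

Lemma irrep_inj (i j : IBr) : mx_rsim (irrep i) (irrep j) -> i = j.
Proof.
move=> sim_ij; rewrite -[i]reprK -[j]reprK.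
by apply/eqP; rewrite eqmodE; apply/asboolP.
Qed.

Lemma compseries_exists n (rG : mx_representation F G n) :
  exists U : seq 'M[F]_n,
    mx_composition_series rG U /\ (last 0%R U :=: (1%:M)%R)%MS.
Proof.
apply/asboolP.
apply: (@mx_Schreier _ _ _ _ rG [::]) => // -[U [compU lastU _]].
by apply/asboolP; exists U.
Qed.

Definition compseries n (rG : mx_representation F G n) : seq 'M[F]_n :=
  sval (cid (compseries_exists rG)).

Lemma compseriesP n (rG : mx_representation F G n) :
  mx_composition_series rG (compseries rG).
Proof. by rewrite /compseries; case: cid => U []. Qed.

Lemma compseries_last n (rG : mx_representation F G n) :
  (last 0%R (compseries rG) :=: (1%:M)%R)%MS.
Proof. by rewrite /compseries; case: cid => U []. Qed.

(* Every simple module is a composition factor of the regular module, so IBr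
   injects into the positions of a composition series of the latter. *)
Let m := size (compseries (regular_repr F G)).

Let rank_exists (i : IBr) : exists k : 'I_m,
  mx_rsim (irrep i) (series_repr k (compseriesP (regular_repr F G))).
Proof.
apply: rsim_regular_series; first exact: irr_reprP.
exact: compseries_last.
Qed.

Definition IBr_rank (i : IBr) : 'I_m := sval (cid (rank_exists i)).

Lemma IBr_rank_inj : injective IBr_rank.
Proof.
move=> i j; rewrite /IBr_rank; case: cid => k simi; case: cid => l simj /= ekl.
apply: irrep_inj; apply: mx_rsim_trans simi _; apply: mx_rsim_sym.
by rewrite ekl.
Qed.

Definition IBr_unrank (k : 'I_m) : option IBr :=
  match pselect (exists i, IBr_rank i = k) with
  | left ex => Some (sval (cid ex))
  | right _ => None
  end.

Lemma IBr_rankK : pcancel IBr_rank IBr_unrank.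
Proof.
move=> i; rewrite /IBr_unrank; case: pselect => [ex | []]; last by exists i.
by case: cid => j /= /IBr_rank_inj ->.
Qed.

HB.instance Definition _ := PCanIsCountable IBr_rankK.
HB.instance Definition _ : isFinite IBr := PCanIsFinite IBr_rankK.

(* By Jordan-Hoelder, the Grothendieck group of finite-dimensional FG-modules
   is freely generated by IBr, the coordinates of the class of a module being
   the multiplicities of its composition factors. *)
Definition Groth := {ffun IBr -> int}.

Definition Groth_irr (i : IBr) : Groth := [ffun j => (j == i)%:R%R].

Definition Groth_class n (rG : mx_representation F G n) : Groth :=
  [ffun i => (#|[set k : 'I_(size (compseries rG)) |
     `[< mx_rsim (series_repr k (compseriesP rG)) (irrep i) >]]|)%:R%R].

Definition Groth_ext (V : zmodType) (f : IBr -> V) (eta : Groth) : V :=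
  (\sum_(i : IBr) f i *~ eta i)%R.

End IrreducibleBrauer.

Arguments IBr F {gT} G%_G.
Arguments Groth F {gT} G%_G.

Section Restriction.

Variables (F : closedFieldType) (gT : finGroupType) (H G : {group gT}).
Hypothesis sHG : H \subset G.

Definition IBr_over (zeta : IBr F H) : {set IBr F G} :=
  [set i : IBr F G | `[< exists (U : 'M[F]_(irr_degree (irrep i)))
     (modU : mxmodule (subg_repr (irrep i) sHG) U),
     affords (submod_repr modU) zeta >]].

(* eta belongs to R(G | zeta) *)
Definition in_Groth_over (zeta : IBr F H) (eta : Groth F G) : Prop :=
  forall i, i \notin IBr_over zeta -> eta i = 0%R.

Definition Groth_Res : Groth F G -> Groth F H :=
  Groth_ext (fun i => Groth_class (subg_repr (irrep i) sHG)).

End Restriction.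

Section Twist.

Variables (F : closedFieldType) (gT : finGroupType) (H : {group gT}).

Lemma twist_mx_repr n (rH : mx_representation F H n) (f : gT -> gT)
    (fM : {in H &, {morph f : x y / x * y}}) (fH : {in H, forall x, f x \in H}) :
  mx_repr H (fun x => rH (f x)).
Proof.
split=> [|x y Hx Hy]; last by rewrite fM // repr_mxM ?fH.
suff ->: f 1 = 1 by rewrite repr_mx1.
by apply: (mulgI (f 1)); rewrite -fM ?group1 // !mulg1.
Qed.

Definition twist_repr n (rH : mx_representation F H n) (f : gT -> gT)
    (fM : {in H &, {morph f : x y / x * y}}) (fH : {in H, forall x, f x \in H}) :=
  MxRepresentation (twist_mx_repr rH fM fH).

Definition twist_fixes (f : gT -> gT) (chi : IBr F H) : Prop :=
  exists (fM : {in H &, {morph f : x y / x * y}})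
         (fH : {in H, forall x, f x \in H}),
    affords (twist_repr (irrep chi) fM fH) chi.

Lemma twist_fixesP f chi : twist_fixes f chi <->
  [/\ {in H &, {morph f : x y / x * y}}, {in H, forall x, f x \in H} &
    exists2 B, B \in unitmx & {in H, forall x,
      (irrep chi (f x) *m B = B *m irrep chi x)%R}].
Proof.
split=> [[fM [fH /mx_rsim_def[B [B' BB' simB]]]] | [fM fH [B uB simB]]].
  split=> //; have uB: B \in unitmx by have [_] := mulmx1_unit BB'.
  exists B => // x Hx; have /= -> := simB x Hx.
  by rewrite -!mulmxA BB' mulmx1.
by exists fM, fH; exists B => //; rewrite row_free_unit.
Qed.

(* The stabilizer of chi under conjugation.  The conjugate of a representation
   P by g is x |-> P (g^-1 * x * g) = P (x ^ g). *)
Definition IBr_stab (A : {set gT}) (chi : IBr F H) : {set gT} :=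
  [set g in 'N_A(H) | `[< twist_fixes (conjg^~ g) chi >]].

Lemma IBr_stab_group_set (A : {group gT}) chi : group_set (IBr_stab A chi).
Proof.
apply/group_setP; split=> [|g h].
  rewrite inE group1; apply/asboolP/twist_fixesP.
  split=> [x y _ _|x Hx|]; rewrite ?conjg1 //.
  by exists (1%:M)%R => [|x Hx]; rewrite ?unitmx1 // conjg1 mulmx1 mul1mx.
rewrite ![_ \in IBr_stab _ _]inE.
case/andP=> Ng /asboolP/twist_fixesP[_ gH [B uB simB]].
case/andP=> Nh /asboolP/twist_fixesP[_ hH [C uC simC]].
rewrite groupM //=.
apply/asboolP/twist_fixesP; split=> [x y _ _|x Hx|]; first by rewrite conjMg.
  by rewrite conjgM hH ?gH.
exists (C *m B)%R => [|x Hx]; first by rewrite unitmx_mul uB uC.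
by rewrite conjgM mulmxA simC ?gH // -!mulmxA simB.
Qed.

Canonical IBr_stab_group (A : {group gT}) chi := Group (IBr_stab_group_set A chi).

(* Automorphisms act by P |-> P \o a^-1. *)
Definition aut_fix (chi : IBr F H) : {set {perm gT}} :=
  [set a : {perm gT} | `[< twist_fixes (a^-1)%g chi >]].

End Twist.

(* The cocycle is unique as soon as n > 0. *)
Record proj_repr (F : fieldType) (aT : finGroupType) (A : {set aT}) (n : nat) :=
  ProjRepr {
    proj_mx :> aT -> 'M[F]_n;
    proj_cocycle : aT -> aT -> F;
    _ : proj_mx 1 = (1%:M)%R;
    _ : {in A, forall a, proj_mx a \in unitmx};
    _ : {in A &, forall a b, proj_cocycle a b != 0%R};
    _ : {in A & &, forall a b c,
          (proj_cocycle a b * proj_cocycle (a * b)%g c =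
           proj_cocycle b c * proj_cocycle a (b * c)%g)%R};
    _ : {in A &, forall a b,
          (proj_mx a *m proj_mx b = proj_cocycle a b *: proj_mx (a * b)%g)%R}
  }.

(* Permutations compose from left to right and conj_aut X x is
   y |-> x^-1 * y * x; through a |-> a^-1 this corresponds to the
   right-to-left composition and the inner automorphism y |-> x * y * x^-1.
   The identification of X / Z with the group of inner automorphisms is thus
   induced by conj_aut X.  Since Z is contained in Y, a section s of X -> X / Z
   restricts to a section Y / Z -> Y. *)
Definition cohom_cond (F : closedFieldType) (gT : finGroupType)
    (X Y Z : {group gT}) (chi : IBr F X) (psi : IBr F Y) : Prop :=
  let Achi := Aut X :&: aut_fix chi in
  let AYpsi := 'N_(Aut X)(Y | 'P) :&: aut_fix psi in
  exists (n m : nat) (P : proj_repr F Achi n) (Q : proj_repr F AYpsi m)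
    (s : coset_of Z -> gT)
    (L : mx_representation F X n) (M : mx_representation F Y m),
  [/\ {in X / Z, forall c, s c \in X /\ coset Z (s c) = c} /\ s 1 = 1,
      affords L chi /\ {in X, forall x, P (conj_aut X x) = L (s (coset Z x))},
      affords M psi /\ {in Y, forall y, Q (conj_aut X y) = M (s (coset Z y))} &
      {in AYpsi :&: Achi &, forall a b, proj_cocycle P a b = proj_cocycle Q a b}].

Section TensorWithQuotient.

Variables (F : closedFieldType) (gT : finGroupType) (H N : {group gT}).
Hypothesis nNH : H \subset 'N(N).

Definition Groth_tensor (eta : Groth F H) n
    (rB : mx_representation F (H / N)%G n) : Groth F H :=
  Groth_ext (fun i =>
    Groth_class (prod_repr (irrep i) (morphim_repr rB nNH))) eta.

End TensorWithQuotient.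

Section SubgroupCorrespondence.

Variables (gT rT : finGroupType) (G N : {group gT}) (M : {group rT}).
Variable tau : {morphism (G / N) >-> coset_of M}.

Definition tau_sub (H : {group gT}) : {group rT} :=
  (coset M @*^-1 (tau @* (H / N)))%G.

Lemma sub_tau_sub H : M \subset tau_sub H.
Proof. exact: sub_cosetpre. Qed.

Lemma tau_sub_norm H : tau_sub H \subset 'N(M).
Proof. exact: subsetIl. Qed.

Lemma tau_subS (K H : {group gT}) :
  K \subset H -> tau_sub K \subset tau_sub H.
Proof. by move=> sKH; rewrite morphpreS // morphimS // quotientS. Qed.

Variable F : closedFieldType.

Lemma tau_mx_repr (injt : 'injm tau) (H : {group gT}) (sHG : H \subset G) n
    (rB : mx_representation F (H / N)%G n) :
  mx_repr (tau_sub H / M)%G (fun y => rB (invm injt y)).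
Proof.
have sHGq: H / N \subset G / N by rewrite quotientS.
have inv_in y: y \in tau_sub H / M ->
    y \in tau @* (G / N) /\ invm injt y \in H / N.
  rewrite /= cosetpreK => ty; split; first exact: subsetP (morphimS _ sHGq) _ ty.
  by case/morphimP: ty => x Gx Hx ->; rewrite invmE.
split=> [|y z /inv_in[ty Hy] /inv_in[tz Hz]]; first by rewrite morph1 repr_mx1.
by rewrite morphM // repr_mxM.
Qed.

(* The representation y |-> rB (tau^-1 y). *)
Definition tau_repr (injt : 'injm tau) (H : {group gT}) (sHG : H \subset G) n
    (rB : mx_representation F (H / N)%G n) :=
  MxRepresentation (tau_mx_repr injt sHG rB).

End SubgroupCorrespondence.

Definition modular_triple (F : closedFieldType) (gT : finGroupType)
    (G N : {group gT}) (theta : IBr F N) : Prop :=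
  N <| G /\ IBr_stab G theta = G.

(* sigma H is only constrained for N \subset H \subset G and on
   IBr (H | theta). *)
Definition modular_triple_iso (F : closedFieldType) (gT rT : finGroupType)
    (G N : {group gT}) (theta : IBr F N)
    (Gamma M : {group rT}) (phi : IBr F M) : Prop :=
  [/\ modular_triple G theta, modular_triple Gamma phi &
  exists (tau : {morphism (G / N) >-> coset_of M})
    (isot : isom (G / N) (Gamma / M) tau)
    (sigma : forall H : {group gT}, IBr F H -> IBr F (tau_sub tau H)),
  let sigmaR H : Groth F H -> Groth F (tau_sub tau H) :=
    Groth_ext (fun i => Groth_irr (sigma H i)) in
  [/\ forall (H : {group gT}) (sNH : N \subset H), H \subset G ->
        {in IBr_over sNH theta &, injective (sigma H)} /\
        sigma H @: IBr_over sNH theta = IBr_over (sub_tau_sub tau H) phi,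
      forall (K H : {group gT}) (sNK : N \subset K) (sKH : K \subset H),
        H \subset G ->
        forall eta, in_Groth_over (subset_trans sNK sKH) theta eta ->
        sigmaR K (Groth_Res sKH eta) =
          Groth_Res (tau_subS tau sKH) (sigmaR H eta) &
      forall (H : {group gT}) (sNH : N \subset H) (sHG : H \subset G)
        (nNH : H \subset 'N(N)),
        forall eta, in_Groth_over sNH theta eta ->
        forall beta : IBr F (H / N)%G,
        sigmaR H (Groth_tensor nNH eta (irrep beta)) =
          Groth_tensor (tau_sub_norm tau H) (sigmaR H eta)
            (tau_repr (isom_inj isot) sHG (irrep beta))]].

Lemma sub_subnorm (gT : finGroupType) (Y G : {group gT}) :
  Y \subset G -> Y \subset 'N_G(Y).
Proof. by move=> sYG; rewrite subsetI sYG normG. Qed.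

(* Main.v *)
Require Import Defs.
From HB Require Import structures.
From mathcomp Require Import all_boot all_order all_algebra all_fingroup.
From mathcomp Require Import all_solvable all_field all_character.
From mathcomp Require Import boolp.
From mathcomp.real_closed Require mxtens.

Set Implicit Arguments.
Unset Strict Implicit.
Unset Printing Implicit Defensive.

Import GroupScope GRing.Theory.

(** Let [A] be the stabiliser of [chi] in [G] and [B] that of [psi] in
    [N_G(Y)].  By hypothesis [A = X B] and [Y] is the intersection of [X] and
    [B], so [A / X] and [B / Y] are isomorphic.

    The groups [A] and [B] act by conjugation on [X' = [X, X]], and the
    cohomological condition yields, by pull back along this action, projective
    representations of [A] and [B] with a common cocycle on [B].  On [X] and
    [Y] they agree with [chi] and [psi] up to scalars.  These scalars are the
    same on both sides, because the same section of [X' -> X' / Z'] is used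
    and because [Z] acts through the same character [nu] in [chi] and [psi].
    Keeping only their values on a transversal of [Y] in [B] (which is one of
    [X] in [A]) and extending by translation gives projective representations
    [P] and [Q] that extend [chi] and [psi], with one and the same cocycle,
    inflated from the quotient ([renorm_proj_ext]).  Translation on both sides
    is only consistent if [P(g)] intertwines [chi] with its conjugate by [g]
    exactly, not just up to a scalar.  For fixed [g] this scalar is a linear
    character of [X], trivial on [X'] and also on the central subgroup [Z],
    so trivial on [X = X' Z] ([twist_scalar_trivial]).  As a function of the
    cocycle and of the scalars above it is the same for [Q].

    For [H] between [X] and [A], every simple module of [H] over [chi] is
    [P (x) R] for a projective representation [R] of [H / X] with the inverse
    cocycle, unique up to similarity ([tens_decomposition],
    [rsim_twisted_sim]).  Since [H / X] is also the quotient by [Y] of the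
    intersection [K] of [H] and [B], the same [R] makes [Q (x) R] a simple
    module of [K], and [P (x) R |-> Q (x) R] is the correspondence sought.
    Restriction to subgroups and tensoring with modules of [H / X] affect [R]
    only.  They destroy simplicity, so one has to know that [P (x) R] and
    [Q (x) R] also correspond in the Grothendieck groups for reducible [R];
    this follows from the additivity of classes ([Groth_class_exact]), by
    putting [R] in block triangular form ([corresponds_class]).

    The equality of cardinals combines the correspondence for [H = A] with the
    Clifford correspondence, in arbitrary characteristic, on both sides
    ([Clifford_correspondence]). *)

(** * Homomorphisms between modules, and classes of simple modules *)

Section UnitMatrix.

Variables (F : fieldType) (n : nat) (M : 'M[F]_n).
Hypotheses (n_gt0 : (0 < n)%N) (uM : M \in unitmx).
Local Open Scope ring_scope.

Lemma unitmx_neq0 : M != 0.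
Proof.
apply: contraTneq uM => ->.
by rewrite -row_free_unit /row_free mxrank0 eq_sym -lt0n.
Qed.

Lemma scale_unitmx_inj a b : a *: M = b *: M -> a = b.
Proof.
move=> /eqP; rewrite -subr_eq0 -scalerBl scaler_eq0 subr_eq0.
by rewrite (negPf unitmx_neq0) orbF => /eqP.
Qed.

End UnitMatrix.

Section Homs.

Variables (F : fieldType) (gT : finGroupType) (G : {group gT}).
Local Open Scope ring_scope.

Definition repr_hom n1 (r1 : mx_representation F G n1)
    n2 (r2 : mx_representation F G n2) (B : 'M[F]_(n1, n2)) : Prop :=
  {in G, forall x, r1 x *m B = B *m r2 x}.

Variables (n1 n2 : nat) (r1 : mx_representation F G n1).
Variables (r2 : mx_representation F G n2).

Lemma repr_hom_row_free B :
  mx_irreducible r1 -> repr_hom r1 r2 B -> B != 0 -> row_free B.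
Proof.
move=> irr1 homB nzB; have [n1_gt0 irr] := (mx_irrP r1).1 irr1.
rewrite -kermx_eq0; apply: contraR nzB => nzK.
suff: row_full (kermx B).
  by rewrite -sub1mx => /sub_kermxP; rewrite mul1mx => ->.
apply: irr nzK; apply/mxmoduleP=> x Gx; apply/sub_kermxP.
by rewrite -mulmxA homB // mulmxA mulmx_ker mul0mx.
Qed.

Lemma repr_hom_row_full B :
  mx_irreducible r2 -> repr_hom r1 r2 B -> B != 0 -> row_full B.
Proof.
move=> irr2 homB nzB; have [n2_gt0 irr] := (mx_irrP r2).1 irr2.
rewrite -sub1mx -(genmxE B) sub1mx irr //; last first.
  by rewrite -!mxrank_eq0 genmxE mxrank_eq0 in nzB *.
rewrite (eqmx_module _ (genmxE _)).
by apply/mxmoduleP=> x Gx; rewrite -homB // submxMl.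
Qed.

(** Schur's lemma between two representations on different spaces. *)
Lemma repr_hom_rsim B :
    mx_irreducible r1 -> mx_irreducible r2 -> repr_hom r1 r2 B -> B != 0 ->
  mx_rsim r1 r2.
Proof.
move=> irr1 irr2 homB nzB; have freeB := repr_hom_row_free irr1 homB nzB.
have fullB := repr_hom_row_full irr2 homB nzB.
by exists B => //; rewrite -(eqP freeB) (eqP fullB).
Qed.

Lemma mx_rsim_hom : mx_rsim r1 r2 -> exists B B',
  [/\ B *m B' = 1%:M, B' *m B = 1%:M, repr_hom r1 r2 B & repr_hom r2 r1 B'].
Proof.
case=> B def_n freeB homB; move: B freeB homB; rewrite /repr_hom.
case: n2 / def_n r2 => r B; rewrite row_free_unit => uB homB.
exists B, (invmx B); rewrite mulmxV // mulVmx //; split=> // x Gx.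
by rewrite -[r x]mul1mx -(mulVmx uB) -!mulmxA (mulmxA B) -homB // mulmxK.
Qed.

Lemma inv_hom_rsim B B' : B *m B' = 1%:M -> B' *m B = 1%:M ->
  repr_hom r1 r2 B -> mx_rsim r1 r2.
Proof.
move=> BB' B'B homB; have freeB: row_free B by apply/row_freeP; exists B'.
have fullB: row_full B by apply/row_fullP; exists B'.
by exists B => //; rewrite -(eqP freeB) (eqP fullB).
Qed.

End Homs.

Section Class.

Variables (F : closedFieldType) (gT : finGroupType) (G : {group gT}).

Lemma closed_irr_abs n (r : mx_representation F G n) :
  mx_irreducible r -> mx_absolutely_irreducible r.
Proof. exact: (@group_closure_closed_field F gT). Qed.

Lemma irr_affords n (r : mx_representation F G n) :
  mx_irreducible r -> exists i : IBr F G, mx_rsim r (irrep i).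
Proof.
move=> irr; exists (\pi_(IBr F G) (IrrRepr irr))%qT.
have /eqmodP/asboolP // : (\pi_(IBr F G) (IrrRepr irr) =
  \pi_(IBr F G) (generic_quotient.repr (\pi_(IBr F G) (IrrRepr irr))))%qT.
by rewrite reprK.
Qed.

Lemma IBr_inhabited : exists i : IBr F G, True.
Proof.
have mx1 : mx_repr G (fun _ : gT => 1%:M%R : 'M[F]_1).
  by split=> // g h _ _; rewrite mulmx1.
have lin := linear_mx_abs_irr (MxRepresentation mx1) (erefl _).
by have [i _] := irr_affords (mx_abs_irrW lin); exists i.
Qed.

End Class.

Arguments IBr_inhabited F {gT} G.

Section OverHom.

Variables (F : closedFieldType) (gT : finGroupType) (N G : {group gT}).
Variables (sNG : N \subset G) (zeta : IBr F N).
Local Open Scope ring_scope.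

Lemma simple_hom_submod n (r : mx_representation F N n)
    d (r0 : mx_representation F N d) (B : 'M[F]_(d, n)) :
  mx_irreducible r0 -> repr_hom r0 r B -> B != 0 ->
  exists modU : mxmodule r <<B>>%MS, mx_rsim (submod_repr modU) r0.
Proof.
move=> irr0 homB nzB; have freeB := repr_hom_row_free irr0 homB nzB.
have modB: mxmodule r <<B>>%MS.
  rewrite (eqmx_module _ (genmxE _)).
  by apply/mxmoduleP=> x Gx; rewrite -homB // submxMl.
exists modB; apply: mx_rsim_sym; exists (in_submod <<B>>%MS B).
- by rewrite genmxE (eqP freeB).
- by rewrite /row_free mxrank_in_submod ?genmxE.
move=> x Gx /=; rewrite -(in_submodJ modB) ?genmxE // -homB //.
by rewrite in_submodE [RHS]in_submodE mulmxA.
Qed.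

(** By simplicity, a nonzero homomorphism from a module affording [zeta] is
    injective.  Unlike a submodule with its own basis, such a matrix can be
    composed with other homomorphisms. *)
Lemma IBr_overP i : i \in IBr_over sNG zeta <->
  exists2 B : 'M[F]_(_, _), B != 0 &
    repr_hom (irrep zeta) (subg_repr (irrep i) sNG) B.
Proof.
split=> [|[B nzB homB]].
  rewrite inE => /asboolP[U [modU /mx_rsim_sym[B def_n freeB homB]]].
  exists (val_submod B).
    rewrite val_submod_eq0 -mxrank_eq0 (eqP freeB).
    by have /mx_irrP[] := Defs.irr_reprP (irrep zeta); rewrite lt0n.
  move=> x Nx /=; rewrite -(val_submodJ modU) // -homB //.
  by rewrite !(val_submodE (_ *m _)) !(val_submodE B) !mulmxA.
rewrite inE; apply/asboolP.
have [modU simU] := simple_hom_submod (Defs.irr_reprP _) homB nzB.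
by exists <<B>>%MS, modU.
Qed.

Lemma rsim_over n (r : mx_representation F G n) i : mx_rsim r (irrep i) ->
  i \in IBr_over sNG zeta <->
  exists2 B : 'M[F]_(_, _), B != 0 &
    repr_hom (irrep zeta) (subg_repr r sNG) B.
Proof.
move=> /mx_rsim_hom[D [D' [DD' D'D homD homD']]]; rewrite IBr_overP.
have G_ := subsetP sNG; split=> -[B nzB homB].
  exists (B *m D') => [|x Nx]; last first.
    by rewrite /= mulmxA homB // -!mulmxA homD' ?G_.
  by apply: contraNneq nzB => BD0; rewrite -[B]mulmx1 -D'D mulmxA BD0 mul0mx.
exists (B *m D) => [|x Nx]; last first.
  by rewrite /= mulmxA homB // -!mulmxA homD ?G_.
by apply: contraNneq nzB => BD0; rewrite -[B]mulmx1 -DD' mulmxA BD0 mul0mx.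
Qed.

End OverHom.

(** * Additivity of classes in the Grothendieck group *)

Section Sections.

Variables (F : fieldType) (gT : finGroupType) (G : {group gT}).
Local Open Scope ring_scope.

Lemma in_factmodM n (U : 'M[F]_n) a b (A : 'M_(a, b)) (B : 'M_(b, n)) :
  in_factmod U (A *m B) = A *m in_factmod U B.
Proof. by rewrite /in_factmod /= mulmxA. Qed.

Lemma in_submodM n (U : 'M[F]_n) a b (A : 'M_(a, b)) (B : 'M_(b, n)) :
  in_submod U (A *m B) = A *m in_submod U B.
Proof. by rewrite /in_submod /= !mulmxA. Qed.

Lemma val_submodM n (U : 'M[F]_n) a b (A : 'M_(a, b)) (B : 'M_(b, \rank U)) :
  val_submod (A *m B) = A *m val_submod B.
Proof. by rewrite /val_submod /= mulmxA. Qed.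

(** A basis of the quotient [V / U] on which [G] acts through [r], lifted to
    [V]: sections can then be compared without going through the bases chosen
    for submodules and quotients. *)
Definition section_basis n (rG : mx_representation F G n) (U V : 'M_n)
    d (r : mx_representation F G d) (w : 'M[F]_(d, n)) : Prop :=
  [/\ (w <= V)%MS, (V <= w + U)%MS, forall u : 'rV_d, (u *m w <= U)%MS -> u = 0
    & {in G, forall x, (r x *m w - w *m rG x <= U)%MS}].

Lemma section_basis_rsim n (rG : mx_representation F G n) (U V : 'M_n)
    (modU : mxmodule rG U) (modV : mxmodule rG V)
    d (r : mx_representation F G d) (w : 'M[F]_(d, n)) :
  section_basis rG U V r w -> mx_rsim r (section_repr modU modV).
Proof.
case=> wV Vw w_free w_hom; set UV := <<in_factmod U V>>%MS.
have wUV: (in_factmod U w <= UV)%MS by rewrite genmxE submxMr.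
have valK: val_submod (in_submod UV (in_factmod U w)) = in_factmod U w.
  exact: in_submodK.
have freeD: row_free (in_submod UV (in_factmod U w)).
  rewrite -kermx_eq0; apply/rowV0P=> u /sub_kermxP uD0; apply: w_free.
  by rewrite -in_factmod_eq0 in_factmodM -valK -val_submodM uD0 linear0.
have fullD: row_full (in_submod UV (in_factmod U w)).
  rewrite -sub1mx -val_submodS valK val_submod1 genmxE.
  rewrite -in_factmod_addsK (submx_trans (submxMr _ (_ : _ <= w + U)%MS)) //.
    by rewrite addsmx_sub Vw addsmxSr.
  by rewrite addsmxC in_factmod_addsK.
exists (in_submod UV (in_factmod U w)) => //.
  by rewrite -(eqP freeD) (eqP fullD).
move=> x Gx; have modUV := section_module modU modV.
rewrite -(in_submodJ modUV) // -in_factmodJ // -in_submodM -in_factmodM.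
by congr in_submod; apply/eqP; rewrite -subr_eq0 -raddfB in_factmod_eq0 w_hom.
Qed.

Lemma section_basis_exists n (rG : mx_representation F G n) (U V : 'M_n)
    (modU : mxmodule rG U) (modV : mxmodule rG V) : (U <= V)%MS ->
  exists w, section_basis rG U V (section_repr modU modV) w.
Proof.
move=> sUV; set UV := <<in_factmod U V>>%MS.
pose w := val_factmod (val_submod (1%:M : 'M_(\rank UV))).
have inw: in_factmod U w = val_submod 1%:M by rewrite val_factmodK.
exists w; split=> [||u|x Gx].
- rewrite -(addsmx_idPr sUV) (submx_trans _ (proj_factmodS _ _)) //.
  by rewrite submxMr // val_submod1 genmxE.
- rewrite -{1}(in_factmodsK sUV) addsmxC addsmxS // val_factmodS.
  by rewrite val_submod1 genmxE.
- by rewrite -in_factmod_eq0 in_factmodM inw -val_submodE val_submod_eq0 => /eqP.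
rewrite -in_factmod_eq0 raddfB /= in_factmodJ // inw.
rewrite in_factmodM inw -val_submodE subr_eq0.
rewrite -[X in val_submod X]mul1mx.
by rewrite (val_submodJ (section_module modU modV)).
Qed.

End Sections.

Section ShortExact.

Variables (F : fieldType) (gT : finGroupType) (G : {group gT}).
Local Open Scope ring_scope.

Variables (n n1 n2 : nat) (r : mx_representation F G n).
Variables (r1 : mx_representation F G n1) (r2 : mx_representation F G n2).
Variables (I : 'M[F]_(n1, n)) (J : 'M[F]_(n, n2)).
Hypotheses (homI : repr_hom r1 r I) (homJ : repr_hom r r2 J).
Hypotheses (freeI : row_free I) (fullJ : row_full J) (IJ0 : I *m J = 0).
Hypothesis def_n : n = (n1 + n2)%N.

(* Given an exact sequence [0 -> r1 -> r -> r2 -> 0] with maps [I] and [J],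
   submodules of [r1] are pushed forward and those of [r2] pulled back. *)
Let push (A : 'M_n1) := <<A *m I>>%MS.
Let pull (B : 'M_n2) := kermx (J *m cokermx B).

Let sub_pull m (A : 'M_(m, n)) B : (A <= pull B)%MS = (A *m J <= B)%MS.
Proof. by rewrite (sameP sub_kermxP eqP) mulmxA submxE. Qed.

Let push_module A : mxmodule r1 A -> mxmodule r (push A).
Proof.
move=> modA; rewrite (eqmx_module _ (genmxE _)); apply/mxmoduleP=> x Gx.
by rewrite -mulmxA -homI // mulmxA submxMr // (mxmoduleP modA).
Qed.

Let pull_module B : mxmodule r2 B -> mxmodule r (pull B).
Proof.
move=> modB; apply/mxmoduleP=> x Gx.
rewrite sub_pull -mulmxA homJ // mulmxA.
by apply: submx_trans (submxMr _ _) (mxmoduleP modB x Gx); rewrite -sub_pull.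
Qed.

Let push1_pull0 A : (A :=: 1%:M)%MS -> (push A :=: pull 0)%MS.
Proof.
move=> A1; apply/eqmxP; rewrite -(geq_leqif (mxrank_leqif_eq _)).
  have pullK: (pull 0 <= kermx J)%MS.
    by apply/sub_kermxP/eqP; rewrite -submx0 -sub_pull.
  rewrite (leq_trans (mxrankS pullK)) // mxrank_ker (eqP fullJ).
  rewrite (canLR (addnK n2) def_n).
  by rewrite genmxE mxrankMfree // A1 mxrank1.
by rewrite genmxE sub_pull -mulmxA IJ0 mulmx0 sub0mx.
Qed.

Let push_section A B (modA : mxmodule r1 A) (modB : mxmodule r1 B)
    U V (modU : mxmodule r U) (modV : mxmodule r V) :
    (A <= B)%MS -> (U :=: push A)%MS -> (V :=: push B)%MS ->
  mx_rsim (section_repr modA modB) (section_repr modU modV).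
Proof.
move=> sAB defU defV; have {}defU := eqmx_trans defU (genmxE _).
have {}defV := eqmx_trans defV (genmxE _); move: (section_basis_exists modA modB sAB).
move: (section_repr modA modB) => r' [w [wB Bw w_free w_hom]].
apply: (@section_basis_rsim _ _ _ _ _ _ _ _ _ _ _ (w *m I)).
split=> [||u|x Gx].
- by rewrite defV submxMr.
- apply: (@submx_trans _ _ _ _ _ _ (B *m I)); first by rewrite defV.
  by apply: submx_trans (submxMr I Bw) _; rewrite addsmxMr addsmxS // defU.
- by rewrite defU mulmxA submxMfree // => /w_free.
rewrite defU.
by rewrite mulmxA -(mulmxA w) -homI // mulmxA -mulmxBl submxMr // w_hom.
Qed.

Let pull_section A B (modA : mxmodule r2 A) (modB : mxmodule r2 B)
    U V (modU : mxmodule r U) (modV : mxmodule r V) :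
    (A <= B)%MS -> (U :=: pull A)%MS -> (V :=: pull B)%MS ->
  mx_rsim (section_repr modA modB) (section_repr modU modV).
Proof.
move=> sAB defU defV; move: (section_basis_exists modA modB sAB).
move: (section_repr modA modB) => r' [w [wB Bw w_free w_hom]].
have [J' J'J] := row_fullP fullJ.
apply: (@section_basis_rsim _ _ _ _ _ _ _ _ _ _ _ (w *m J')).
split=> [||u|x Gx].
- by rewrite defV sub_pull -mulmxA J'J mulmx1.
- apply/rV_subP=> v; rewrite defV sub_pull => vB.
  have /sub_addsmxP[[a b] /= def_vJ] := submx_trans vB Bw.
  rewrite -[v](subrK (a *m (w *m J'))) addrC addmx_sub_adds ?submxMl //.
  by rewrite defU sub_pull mulmxBl def_vJ -!mulmxA J'J mulmx1 addrC addKr submxMl.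
- by rewrite defU sub_pull -!mulmxA J'J mulmx1 => /w_free.
rewrite defU sub_pull.
by rewrite mulmxBl -!mulmxA homJ // (mulmxA J') J'J mulmx1 mul1mx w_hom.
Qed.

(** Pushing forward a composition series of [r1] and continuing with the pull
    back of one of [r2] gives a composition series of [r] with the same
    factors. *)
Lemma concat_series C1 (comp1 : mx_composition_series r1 C1)
    C2 (comp2 : mx_composition_series r2 C2) :
    (last 0 C1 :=: 1%:M)%MS -> (last 0 C2 :=: 1%:M)%MS ->
  exists U (compU : mx_composition_series r U),
    [/\ (last 0 U :=: 1%:M)%MS, size U = (size C1 + size C2)%N,
        forall k, (k < size C1)%N ->
          mx_rsim (series_repr k comp1) (series_repr k compU)
      & forall k, (k < size C2)%N ->
          mx_rsim (series_repr k comp2) (series_repr (size C1 + k) compU)].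
Proof.
move=> last1 last2; have [mod1 max1] := comp1; have [mod2 max2] := comp2.
pose U := map push C1 ++ map pull C2.
have szU: size U = (size C1 + size C2)%N by rewrite size_cat !size_map.
have push0: (push 0 :=: (0 : 'M_n))%MS by rewrite /push mul0mx genmx0.
have nthU1 k: (k <= size C1)%N -> ((0 :: U)`_k :=: push (0 :: C1)`_k)%MS.
  case: k => [_|k lt_k]; first exact: eqmx_sym.
  by rewrite /= nth_cat size_map lt_k (nth_map 0).
have nthU2 k: (k <= size C2)%N ->
    ((0 :: U)`_(size C1 + k) :=: pull (0 :: C2)`_k)%MS.
  case: k => [_|k lt_k].
    rewrite addn0; apply: eqmx_trans (nthU1 _ (leqnn _)) _.
    by rewrite -last_nth; apply: push1_pull0.
  rewrite addnS /= nth_cat size_map ltnNge leq_addr /= addKn.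
  by rewrite (nth_map 0).
have modU: mx_subseries r U.
  rewrite /mx_subseries all_cat !all_map; apply/andP; split.
    by apply: sub_all mod1 => A; apply: push_module.
  by apply: sub_all mod2 => A; apply: pull_module.
have sub1 k: (k < size C1)%N -> ((0 :: C1)`_k <= C1`_k)%MS.
  by case/max1=> /ltmxW.
have sub2 k: (k < size C2)%N -> ((0 :: C2)`_k <= C2`_k)%MS.
  by case/max2=> /ltmxW.
have sim1 k : (k < size C1)%N ->
    mx_rsim (series_repr k comp1) (subseries_repr k modU).
  move=> lt_k; apply: push_section; first exact: sub1.
    exact: nthU1 (ltnW lt_k).
  exact: (nthU1 k.+1).
have sim2 k : (k < size C2)%N ->
    mx_rsim (series_repr k comp2) (subseries_repr (size C1 + k) modU).
  move=> lt_k; apply: pull_section; first exact: sub2.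
    exact: nthU2 (ltnW lt_k).
  by have := nthU2 k.+1 lt_k; rewrite addnS.
have compU: mx_composition_series r U.
  split=> // k; rewrite szU => lt_k.
  have sU: ((0 :: U)`_k <= U`_k)%MS.
    have [lt1|ge1] := ltnP k (size C1).
      rewrite (nthU1 _ (ltnW lt1)) (nthU1 k.+1) // !genmxE submxMr //.
      exact: sub1.
    rewrite -(subnKC ge1); have lt2: (k - size C1 < size C2)%N.
      by rewrite ltn_subLR.
    have := nthU2 _ lt2; rewrite addnS /= => ->.
    rewrite (nthU2 _ (ltnW lt2)) sub_pull; apply: submx_trans (sub2 _ lt2).
    by rewrite -sub_pull.
  apply/(max_submodP (mx_subseries_module' k modU) (mx_subseries_module k modU)).
    by [].
  have [lt1|ge1] := ltnP k (size C1).
    exact: mx_rsim_irr (sim1 k lt1) (mx_series_repr_irr comp1 lt1).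
  have lt2: (k - size C1 < size C2)%N by rewrite ltn_subLR.
  have := mx_rsim_irr (sim2 _ lt2) (mx_series_repr_irr comp2 lt2).
  by rewrite subnKC.
exists U, compU; split=> //.
- rewrite (last_nth 0) szU; apply: eqmx_trans (nthU2 _ (leqnn _)) _.
  rewrite -last_nth; apply/eqmxP.
  by rewrite submx1 sub_pull mul1mx (submx_trans (submx1 J)) // last2.
- by rewrite /series_repr (bool_irrelevance (proj1 compU) modU); apply: sim1.
by rewrite /series_repr (bool_irrelevance (proj1 compU) modU); apply: sim2.
Qed.

End ShortExact.

Section GrothClass.

Variables (F : closedFieldType) (gT : finGroupType) (G : {group gT}).
Local Open Scope ring_scope.

(** By the Jordan-Hoelder theorem any composition series can be used to compute
    the class of a module. *)
Lemma Groth_class_series n (r : mx_representation F G n) U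
    (compU : mx_composition_series r U) i : (last 0 U :=: 1%:M)%MS ->
  Groth_class r i =
    (\sum_(0 <= k < size U) `[< mx_rsim (series_repr k compU) (irrep i) >])%:R.
Proof.
move=> lastU; rewrite ffunE; congr (_%:R).
have [|szU [p simp]] := mx_JordanHolder (compseriesP r) compU.
  exact: eqmx_trans (compseries_last r) (eqmx_sym lastU).
rewrite -szU big_mkord (reindex_inj (@perm_inj _ p)) -sum1_card big_mkcond.
apply: eq_bigr => k _; rewrite inE -[RHS]/(nat_of_bool _); case: ifP.
  move=> /asboolP sim; case: asboolP => // -[].
  by apply: mx_rsim_trans sim; apply: mx_rsim_sym.
move=> /asboolP nsim; case: asboolP => // sim; case: nsim.
exact: mx_rsim_trans (simp k) sim.
Qed.

Lemma Groth_class_exact n n1 n2 (r : mx_representation F G n)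
    (r1 : mx_representation F G n1) (r2 : mx_representation F G n2)
    (I : 'M[F]_(n1, n)) (J : 'M[F]_(n, n2)) :
    repr_hom r1 r I -> repr_hom r r2 J ->
    row_free I -> row_full J -> I *m J = 0 -> n = (n1 + n2)%N ->
  Groth_class r = Groth_class r1 + Groth_class r2.
Proof.
move=> homI homJ freeI fullJ IJ0 def_n; apply/ffunP=> i.
have [last1 last2] := (compseries_last r1, compseries_last r2).
have [comp1 comp2] := (compseriesP r1, compseriesP r2).
have [U [compU [lastU szU sim1 sim2]]] :=
  concat_series homI homJ freeI fullJ IJ0 def_n comp1 comp2 last1 last2.
rewrite (Groth_class_series compU) // [RHS]ffunE.
rewrite (Groth_class_series comp1) // (Groth_class_series comp2) // -natrD; congr (_%:R).
have eq_sim m1 m2 (s1 : mx_representation F G m1)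
    (s2 : mx_representation F G m2) : mx_rsim s1 s2 ->
    `[< mx_rsim s2 (irrep i) >] = `[< mx_rsim s1 (irrep i) >].
  move=> sim; apply/asboolP/asboolP; apply: mx_rsim_trans => //.
  exact: mx_rsim_sym.
rewrite szU (big_cat_nat (n := size (compseries r1))) ?leq_addr //=.
congr (_ + _)%N.
  by apply: eq_big_nat => k lt_k; rewrite (eq_sim _ _ _ _ (sim1 k lt_k)).
rewrite -{1}[size (compseries r1)]add0n big_addn addKn.
apply: eq_big_nat => k lt_k; rewrite addnC.
by rewrite (eq_sim _ _ _ _ (sim2 k lt_k)).
Qed.

Lemma Groth_class0 n (r : mx_representation F G n) : n = 0 -> Groth_class r = 0.
Proof.
move=> n0; have comp0: mx_composition_series r [::] by split.
apply/ffunP=> i; rewrite (Groth_class_series comp0) ?big_nil ?ffunE //=.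
by rewrite n0 [X in (X :=: _)%MS]thinmx0 [X in (_ :=: X)%MS]thinmx0.
Qed.

Lemma Groth_class_rsim n1 n2 (r1 : mx_representation F G n1)
    (r2 : mx_representation F G n2) :
  mx_rsim r1 r2 -> Groth_class r1 = Groth_class r2.
Proof.
move=> /mx_rsim_sym [B def_n freeB homB].
pose r0 := MxRepresentation (@mx_repr0 F gT G).
(* An isomorphism is a short exact sequence with zero as third term. *)
have ->: Groth_class r1 = Groth_class r2 + Groth_class r0.
  by apply: (@Groth_class_exact _ _ _ r1 r2 r0 B 0) => //;
    [move=> x _; rewrite mulmx0 mul0mx | rewrite /row_full mxrank0
    | rewrite mulmx0 | rewrite addn0].
by rewrite (Groth_class0 r0) ?addr0.
Qed.

Lemma Groth_class_irr n (r : mx_representation F G n) i :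
  mx_rsim r (irrep i) -> Groth_class r = Groth_irr i.
Proof.
move=> sim_i; have irr_r := mx_rsim_irr (mx_rsim_sym sim_i) (Defs.irr_reprP _).
have [mod1 nz1 simple1] := irr_r.
have compU: mx_composition_series r [:: 1%:M].
  split=> [|[|//] _ /=]; first by rewrite /mx_subseries /= mxmodule1.
  split=> [|W [modW ltW]]; first by rewrite lt0mx.
  rewrite ltmxE => /andP[_ /negP[]]; apply: simple1; rewrite ?submx1 //.
  by rewrite -lt0mx.
have sim1: mx_rsim r (series_repr 0 compU).
  apply: (@section_basis_rsim _ _ _ _ _ _ _ _ _ _ _ 1%:M); split=> /=.
  - exact: submx1.
  - by rewrite addsmx0.
  - by move=> u; rewrite mulmx1 submx0 => /eqP.
  by move=> x _; rewrite mulmx1 mul1mx subrr sub0mx.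
apply/ffunP=> j; rewrite (Groth_class_series compU) // big_nat1 ffunE.
congr (_%:R : int); congr nat_of_bool; apply/asboolP/eqP => [sim_j | ->].
  apply: irrep_inj; apply: mx_rsim_trans (mx_rsim_sym sim_j) _.
  exact: mx_rsim_trans (mx_rsim_sym sim1) sim_i.
exact: mx_rsim_trans (mx_rsim_sym sim1) sim_i.
Qed.

End GrothClass.

Section GrothExt.

Variables (F : closedFieldType) (gT : finGroupType) (G : {group gT}).
Local Open Scope ring_scope.
Variable V : zmodType.
Implicit Types (f : IBr F G -> V) (eta : Groth F G).

Lemma Groth_ext_is_zmod_morphism f : zmod_morphism (Groth_ext f : Groth F G -> V).
Proof.
move=> eta eta'; rewrite -sumrB; apply: eq_bigr => i _.
by rewrite !ffunE mulrzBr.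
Qed.

HB.instance Definition _ f :=
  GRing.isZmodMorphism.Build (Groth F G) V (Groth_ext f)
    (Groth_ext_is_zmod_morphism f).

Lemma Groth_ext_irr f i : Groth_ext f (Groth_irr i) = f i.
Proof.
rewrite /Groth_ext (bigD1 i) //= ffunE eqxx mulr1z big1 ?addr0 // => j ne_j.
by rewrite ffunE (negPf ne_j) mulr0z.
Qed.

Lemma eq_Groth_ext f f' eta :
  (forall i, eta i != 0 -> f i = f' i) -> Groth_ext f eta = Groth_ext f' eta.
Proof.
move=> eq_f; apply: eq_bigr => i _; have [->|/eq_f-> //] := eqVneq (eta i) 0.
by rewrite !mulr0z.
Qed.

End GrothExt.

Lemma Groth_ext_comp (F : closedFieldType) (gT rT : finGroupType)
    (G : {group gT}) (H : {group rT}) (V : zmodType)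
    (f : IBr F G -> V) (g : IBr F H -> Groth F G) eta :
  Groth_ext f (Groth_ext g eta) = Groth_ext (fun i => Groth_ext f (g i)) eta.
Proof.
rewrite [in LHS]/Groth_ext -/(Groth_ext f _) raddf_sum.
by apply: eq_bigr => i _; rewrite raddfMz.
Qed.

Lemma in_Groth_over_neq0 (F : closedFieldType) (gT : finGroupType)
    (N H : {group gT}) (sNH : N \subset H) (zeta : IBr F N) eta i :
  in_Groth_over sNH zeta eta -> eta i != 0%R -> i \in IBr_over sNH zeta.
Proof. by move=> over_eta; apply: contraR => /over_eta ->. Qed.

(** * Kronecker products *)

Section Kronecker.

Variable F : fieldType.
Local Open Scope ring_scope.

(** The Kronecker product, as the matrix of [M |-> A^T M B] on matrices viewed
    as row vectors: with this encoding the rules of calculation are those of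
    the matrix product. *)
Definition kron m m' n n' (A : 'M[F]_(m, m')) (B : 'M[F]_(n, n')) :
  'M[F]_(m * n, m' * n') := lin_mx (mulmxr B \o mulmx A^T).

Lemma kronE m m' n n' (A : 'M[F]_(m, m')) (B : 'M[F]_(n, n')) M :
  mxvec M *m kron A B = mxvec (A^T *m M *m B).
Proof. by rewrite mul_vec_lin. Qed.

Lemma mxvec_ext m n p (X Y : 'M[F]_(m * n, p)) :
  (forall M : 'M_(m, n), mxvec M *m X = mxvec M *m Y) -> X = Y.
Proof.
move=> eqXY; apply/row_matrixP=> i; rewrite !rowE -[delta_mx 0 i]vec_mxK.
exact: eqXY.
Qed.

Lemma mx_rank1_sum m n (M : 'M[F]_(m, n)) :
  M = \sum_k (delta_mx k 0 : 'cV_m) *m row k M.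
Proof.
rewrite {1}[M]matrix_sum_delta; apply: eq_bigr => i _.
apply/matrixP=> k j; rewrite summxE mxE big_ord1 !mxE eqxx andbT.
rewrite (bigD1 j) //= !mxE eqxx andbT big1 ?addr0 1?mulrC // => l ne_l.
by rewrite !mxE (eq_sym j) (negPf ne_l) andbF mulr0.
Qed.

(** Pure tensors are the matrices of rank one; they span. *)
Lemma mxvec_ext1 m n p (X Y : 'M[F]_(m * n, p)) :
    (forall (c : 'cV_m) (w : 'rV_n), mxvec (c *m w) *m X = mxvec (c *m w) *m Y) ->
  X = Y.
Proof.
move=> eqXY; apply: mxvec_ext => M; rewrite [M]mx_rank1_sum linear_sum.
by rewrite !mulmx_suml; apply: eq_bigr => k _; apply: eqXY.
Qed.

Lemma kronM m m' m'' n n' n'' (A : 'M[F]_(m, m')) (A' : 'M[F]_(m', m''))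
    (B : 'M[F]_(n, n')) (B' : 'M[F]_(n', n'')) :
  kron A B *m kron A' B' = kron (A *m A') (B *m B').
Proof. by apply: mxvec_ext => M; rewrite mulmxA !kronE trmx_mul !mulmxA. Qed.

Lemma kron11 m n : kron (1%:M : 'M_m) (1%:M : 'M_n) = 1%:M.
Proof. by apply: mxvec_ext => M; rewrite kronE trmx1 mul1mx !mulmx1. Qed.

Lemma kronZl m m' n n' a (A : 'M[F]_(m, m')) (B : 'M[F]_(n, n')) :
  kron (a *: A) B = a *: kron A B.
Proof.
apply: mxvec_ext => M; rewrite -scalemxAr !kronE -linearZ /=.
by rewrite linearZ /= -!scalemxAl.
Qed.

Lemma kronZr m m' n n' a (A : 'M[F]_(m, m')) (B : 'M[F]_(n, n')) :
  kron A (a *: B) = a *: kron A B.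
Proof.
by apply: mxvec_ext => M; rewrite -scalemxAr !kronE -linearZ /= -scalemxAr.
Qed.

Lemma kron0r m m' n n' (A : 'M[F]_(m, m')) : kron A (0 : 'M_(n, n')) = 0.
Proof. by apply: mxvec_ext => M; rewrite kronE !mulmx0 linear0. Qed.

Lemma kron_injr m n n' (A : 'M[F]_m) (B B' : 'M[F]_(n, n')) :
  (0 < m)%N -> A \in unitmx -> kron A B = kron A B' -> B = B'.
Proof.
move=> m_gt0 uA eqBB'; apply/row_matrixP=> i; rewrite !rowE.
pose k : 'I_m := Ordinal m_gt0.
pose M : 'M_(m, n) := invmx A^T *m ((delta_mx k 0 : 'cV_m) *m delta_mx 0 i).
have := congr1 (mulmx (mxvec M)) eqBB'; rewrite !kronE.
move/(can_inj mxvecK); rewrite /M mulKVmx ?unitmx_tr // -!mulmxA.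
move/(congr1 (row k)); rewrite !row_mul.
have ->: row k (delta_mx k 0 : 'cV[F]_m) = 1%:M.
  by apply/matrixP=> u v; rewrite !ord1 !mxE !eqxx.
by rewrite !mul1mx.
Qed.

End Kronecker.

Section KronAssoc.

Variable F : fieldType.
Local Open Scope ring_scope.

Lemma reindex_conj p q (f : 'I_p -> 'I_q) (g : 'I_q -> 'I_p) :
    cancel f g -> cancel g f ->
  exists A A' : 'M[F]_(_, _), [/\ A *m A' = 1%:M, A' *m A = 1%:M &
    forall (U : 'M_p) (V : 'M_q), (forall x y, U x y = V (f x) (f y)) ->
      U *m A = A *m V].
Proof.
move=> fK gK; pose A : 'M[F]_(p, q) := \matrix_(x, z) (f x == z)%:R.
have mulA (r : nat) (V : 'M_(q, r)) x t : (A *m V) x t = V (f x) t.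
  rewrite mxE (bigD1 (f x)) //= mxE eqxx mul1r big1 ?addr0 // => z ne_z.
  by rewrite mxE eq_sym (negPf ne_z) mul0r.
pose A' : 'M[F]_(q, p) := \matrix_(z, x) (z == f x)%:R.
have mulA' (r : nat) (U : 'M_(p, r)) z t : (A' *m U) z t = U (g z) t.
  rewrite mxE (bigD1 (g z)) //= mxE gK eqxx mul1r big1 ?addr0 // => x ne_x.
  by rewrite mxE -(can_eq gK) fK eq_sym (negPf ne_x) mul0r.
exists A, A'; split.
- by apply/matrixP=> x y; rewrite mulA !mxE (can_eq fK).
- by apply/matrixP=> x y; rewrite mulA' !mxE gK.
move=> U V eqUV; apply/matrixP=> x z; rewrite mulA mxE (bigD1 (g z)) //= mxE gK.
rewrite eqxx mulr1 eqUV gK big1 ?addr0 // => y ne_y.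
by rewrite mxE -(can_eq gK) fK (negPf ne_y) mulr0.
Qed.

Lemma kron_entry m m' n n' (A : 'M[F]_(m, m')) (B : 'M[F]_(n, n')) i j k l :
  kron A B (mxvec_index i k) (mxvec_index j l) = A i j * B k l.
Proof.
have := congr1 (fun u : 'rV__ => u 0 (mxvec_index j l)) (kronE A B (delta_mx i k)).
rewrite /= mxvec_delta -rowE mxE => ->; rewrite mxvecE.
rewrite mxE (bigD1 k) //= big1 => [|k' ne_k]; rewrite mxE (bigD1 i) //= big1.
- by rewrite !mxE !eqxx mulr1 !addr0.
- by move=> i' ne_i; rewrite !mxE (negPf ne_i) mulr0.
- by rewrite !mxE (negPf ne_k) andbF mulr0 addr0 mul0r.
by move=> i' ne_i; rewrite !mxE (negPf ne_i) mulr0.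
Qed.

Lemma trow_entry n1 (A : 'rV[F]_n1) m2 n2 (B : 'M[F]_(m2, n2)) k j l :
  trow A B k (mxtens.mxtens_index (j, l)) = A 0 j * B k l.
Proof.
elim: n1 => [|n1 IHn] in A j *; first by case: j.
rewrite [LHS]/=; case: (split_ordP (j : 'I_(1 + n1))) => j' def_j.
  have -> : mxtens.mxtens_index (j, l) = lshift (n1 * n2) l :> 'I_(n2 + n1 * n2).
    by apply: val_inj; rewrite /= def_j (ord1 j').
  by rewrite row_mxEl !mxE def_j (ord1 j').
have -> : mxtens.mxtens_index (j, l) =
    rshift n2 (mxtens.mxtens_index (j', l)) :> 'I_(n2 + n1 * n2).
  by apply: val_inj; rewrite /= def_j /= mulSn addnA.
by rewrite row_mxEr IHn !mxE def_j.
Qed.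

Lemma tprod_entry m1 n1 (A : 'M[F]_(m1, n1)) m2 n2 (B : 'M[F]_(m2, n2)) i j k l :
  tprod A B (mxtens.mxtens_index (i, k)) (mxtens.mxtens_index (j, l)) =
    A i j * B k l.
Proof.
elim: m1 => [|m1 IHm] in A i *; first by case: i.
rewrite [LHS]/=; case: (split_ordP (i : 'I_(1 + m1))) => i' def_i.
  have -> : mxtens.mxtens_index (i, k) = lshift (m1 * m2) k :> 'I_(m2 + m1 * m2).
    by apply: val_inj; rewrite /= def_i (ord1 i').
  by rewrite col_mxEu trow_entry !mxE def_i (ord1 i').
have -> : mxtens.mxtens_index (i, k) =
    rshift m2 (mxtens.mxtens_index (i', k)) :> 'I_(m2 + m1 * m2).
  by apply: val_inj; rewrite /= def_i /= mulSn addnA.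
by rewrite col_mxEd IHm !mxE def_i.
Qed.

Definition mxvec_unindex m n (k : 'I_(m * n)) : 'I_m * 'I_n :=
  enum_val (cast_ord (esym (mxvec_cast m n)) k).

Lemma mxvec_indexK m n (i : 'I_m) (j : 'I_n) :
  mxvec_unindex (mxvec_index i j) = (i, j).
Proof. by rewrite /mxvec_unindex cast_ordK enum_rankK. Qed.

(** Both [kron] and [tprod] have the products of entries as entries, for two
    different numberings of the pairs of indices, so associativity is a change
    of numbering. *)
Lemma tprod_kron_assoc m n p :
  exists (A : 'M[F]_(m * (n * p), m * n * p)) A',
  [/\ A *m A' = 1%:M, A' *m A = 1%:M &
    forall (U : 'M_m) (V : 'M_n) (W : 'M_p),
      kron U (kron V W) *m A = A *m tprod (kron U V) W].
Proof.
pose f (x : 'I_(m * (n * p))) := let: (i, y) := mxvec_unindex x in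
  let: (j, k) := mxvec_unindex y in mxtens.mxtens_index (mxvec_index i j, k).
pose g (z : 'I_(m * n * p)) := let: (y, k) := mxtens.mxtens_unindex z in
  let: (i, j) := mxvec_unindex y in mxvec_index i (mxvec_index j k).
have fE i j k : f (mxvec_index i (mxvec_index j k)) =
    mxtens.mxtens_index (mxvec_index i j, k) by rewrite /f !mxvec_indexK.
have gE i j k : g (mxtens.mxtens_index (mxvec_index i j, k)) =
    mxvec_index i (mxvec_index j k).
  by rewrite /g mxtens.mxtens_indexK mxvec_indexK.
have fK : cancel f g.
  by move=> x; case/mxvec_indexP: x => i y; case/mxvec_indexP: y => j k; rewrite fE gE.
have gK : cancel g f.
  move=> z; case: (mxtens.mxtens_indexP z) => y k; case/mxvec_indexP: y => i j.
  by rewrite gE fE.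
have [A [A' [AA' A'A conjA]]] := reindex_conj fK gK.
exists A, A'; split=> // U V W; apply: conjA => x y.
case/mxvec_indexP: x => i x; case/mxvec_indexP: x => j k.
case/mxvec_indexP: y => i' y; case/mxvec_indexP: y => j' k'.
by rewrite !fE tprod_entry !kron_entry mulrA.
Qed.

End KronAssoc.

(** * Projective extensions and the modules over them *)

Section ProjectiveExtension.

Variables (F : closedFieldType) (gT : finGroupType).
Local Open Scope ring_scope.

(** An extension of [rX] to a projective representation of [H].  Compatibility
    with translations by [X] on both sides makes the cocycle a function on
    [H / X]. *)
Record proj_ext (X H : {group gT}) n (rX : mx_representation F X n)
    (P : gT -> 'M[F]_n) (a : gT -> gT -> F) : Prop := ProjExt {
  pe_normal : X <| H;
  pe_irr : mx_irreducible rX;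
  pe_unit : {in H, forall h, P h \in unitmx};
  pe_base : {in X, forall x, P x = rX x};
  pe_left : {in X & H, forall x h, P (x * h)%g = rX x *m P h};
  pe_right : {in H & X, forall h x, P (h * x)%g = P h *m rX x};
  pe_mul : {in H &, forall g h, P g *m P h = a g h *: P (g * h)%g}
}.

(** A projective representation of [H / X], inflated to [H], whose cocycle is
    the inverse of [a]: its tensor product with a projective extension of
    cocycle [a] is a linear representation. *)
Record twisted (X H : {group gT}) (a : gT -> gT -> F) e (R : gT -> 'M[F]_e) :
  Prop := Twisted {
  tw_one : R 1%g = 1%:M;
  tw_mul : {in H &, forall g h, a g h *: (R g *m R h) = R (g * h)%g};
  tw_coset : {in X & H, forall x h, R (x * h)%g = R h}
}.

Definition twisted_irr (H : {group gT}) e (R : gT -> 'M[F]_e) : Prop :=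
  (0 < e)%N /\ forall S : 'M_e,
    {in H, forall h, (S *m R h <= S)%MS} -> S != 0 -> row_full S.

Definition twisted_sim (H : {group gT}) e e' (R : gT -> 'M[F]_e)
    (R' : gT -> 'M[F]_e') : Prop :=
  exists C C', [/\ C *m C' = 1%:M, C' *m C = 1%:M &
    {in H, forall h, R h *m C = C *m R' h}].

Section Fixed.

Variables (X H : {group gT}) (n : nat) (rX : mx_representation F X n).
Variables (P : gT -> 'M[F]_n) (a : gT -> gT -> F).
Hypothesis pe : proj_ext H rX P a.

Let n_gt0 : (0 < n)%N. Proof. by case/mx_irrP: (pe_irr pe). Qed.
Let sXH : X \subset H. Proof. exact: normal_sub (pe_normal pe). Qed.
Let sXHP := subsetP sXH.

Lemma pe1 : P 1%g = 1%:M.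
Proof. by rewrite (pe_base pe) // repr_mx1. Qed.

Lemma tens_mx_repr e (R : gT -> 'M[F]_e) :
  twisted X H a R -> mx_repr H (fun h => kron (P h) (R h)).
Proof.
move=> tw; split=> [|g h Hg Hh]; first by rewrite pe1 (tw_one tw) kron11.
rewrite kronM (pe_mul pe) // -(tw_mul tw) // kronZl kronZr.
by [].
Qed.

Definition tens_repr e (R : gT -> 'M[F]_e) (tw : twisted X H a R) :=
  MxRepresentation (tens_mx_repr tw).


Lemma tens_base e (R : gT -> 'M[F]_e) (tw : twisted X H a R) x :
  x \in X -> tens_repr tw x = kron (rX x) 1%:M.
Proof.
move=> Xx /=; rewrite (pe_base pe) //; congr kron.
by rewrite -[x]mulg1 (tw_coset tw) // (tw_one tw).
Qed.

Lemma twisted_sim_rsim e e' (R : gT -> 'M[F]_e) (R' : gT -> 'M[F]_e')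
    (tw : twisted X H a R) (tw' : twisted X H a R') :
  twisted_sim H R R' -> mx_rsim (tens_repr tw) (tens_repr tw').
Proof.
case=> C [C' [CC' C'C simC]].
apply: (@inv_hom_rsim _ _ _ _ _ _ _ (kron 1%:M C) (kron 1%:M C')).
- by rewrite kronM mulmx1 CC' kron11.
- by rewrite kronM mulmx1 C'C kron11.
by move=> h Hh /=; rewrite !kronM mulmx1 mul1mx simC.
Qed.

(** By Burnside's theorem the action of [X] on the first tensor factor spans
    the action of all matrices. *)
Lemma base_span A : exists f : gT -> F, forall e,
  kron A (1%:M : 'M_e) = \sum_(x in X) f x *: kron (rX x) 1%:M.
Proof.
have /mx_abs_irrP[_ [a_ def_A]] := closed_irr_abs (pe_irr pe).
exists (a_ ^~ A) => e; rewrite [in LHS](def_A A).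
apply: mxvec_ext => M; rewrite kronE linear_sum !mulmx_suml linear_sum.
rewrite mulmx_sumr; apply: eq_bigr => x Xx.
by rewrite -scalemxAr kronE linearZ /= -!scalemxAl linearZ.
Qed.

(** A map that commutes with all matrices acting on the first tensor factor
    acts on the second factor only. *)
Lemma kron_centraliser e e' (B : 'M[F]_(n * e, n * e')) :
    {in X, forall x, kron (rX x) 1%:M *m B = B *m kron (rX x) 1%:M} ->
  exists C, B = kron 1%:M C.
Proof.
move=> homB.
have{} homB A : kron A 1%:M *m B = B *m kron A 1%:M.
  have [f span_f] := base_span A; rewrite !span_f mulmx_suml mulmx_sumr.
  by apply: eq_bigr => x Xx; rewrite -scalemxAl -scalemxAr homB.
pose k := Ordinal n_gt0; pose d : 'cV[F]_n := delta_mx k 0.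
pose C := lin1_mx (row k \o vec_mx \o mulmxr B \o mxvec \o mulmx d).
exists C; apply: mxvec_ext1 => c w.
(* [c w] is the image of [d w] under the matrix unit that sends [d] to [c]. *)
have def_c : c *m w = ((delta_mx k 0 : 'cV_n) *m c^T)^T *m (d *m w).
  rewrite trmx_mul trmxK trmx_delta -!mulmxA (mulmxA _ d) mul_delta_mx.
  by rewrite [delta_mx 0 0]mx11_scalar mxE !eqxx mul1mx.
have actB A M : mxvec (A^T *m M) *m B = mxvec M *m B *m kron A 1%:M.
  by rewrite -(mulmxA (mxvec M)) -homB mulmxA kronE mulmx1.
rewrite {1}def_c actB -[mxvec _ *m B]vec_mxK !kronE mulmx1 trmx1 mul1mx.
rewrite -mulmxA trmx_mul trmxK trmx_delta -mulmxA -rowE.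
by rewrite mul_rV_lin1.
Qed.

Lemma rsim_twisted_sim e e' (R : gT -> 'M[F]_e) (R' : gT -> 'M[F]_e')
    (tw : twisted X H a R) (tw' : twisted X H a R') :
  mx_rsim (tens_repr tw) (tens_repr tw') -> twisted_sim H R R'.
Proof.
move=> /mx_rsim_hom[B [B' [BB' B'B homB homB']]].
have [|C def_B] := @kron_centraliser e e' B.
  by move=> x Xx; rewrite -(tens_base tw) // -(tens_base tw') // homB ?sXHP.
have [|C' def_B'] := @kron_centraliser e' e B'.
  by move=> x Xx; rewrite -(tens_base tw) // -(tens_base tw') // homB' ?sXHP.
exists C, C'; split.
- apply: (kron_injr n_gt0 (unitmx1 F n)).
  by rewrite kron11 -BB' def_B def_B' kronM mulmx1.
- apply: (kron_injr n_gt0 (unitmx1 F n)).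
  by rewrite kron11 -B'B def_B def_B' kronM mulmx1.
move=> h Hh; apply: (kron_injr n_gt0 (pe_unit pe Hh)).
by have /= := homB h Hh; rewrite def_B !kronM mulmx1 mul1mx.
Qed.

Lemma tens_module_mx e (R : gT -> 'M[F]_e) (tw : twisted X H a R) m
    (U : 'M_(m, n * e)) A M :
  mxmodule (tens_repr tw) U -> (mxvec M <= U)%MS -> (mxvec (A *m M) <= U)%MS.
Proof.
move=> modU MU; have [f span_f] := base_span A^T.
have ->: mxvec (A *m M) = mxvec M *m kron A^T 1%:M.
  by rewrite kronE trmxK mulmx1.
rewrite span_f mulmx_sumr summx_sub // => x Xx.
by rewrite -scalemxAr scalemx_sub // -(tens_base tw) // mxmodule_trans ?sXHP.
Qed.

(** A nonzero submodule is stable under all matrices on the first factor, so it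
    contains a tensor [d (x) w] for a fixed [d] and some nonzero [w]; the
    vectors [w] with this property form a stable subspace of the second
    factor. *)
Lemma tens_irr e (R : gT -> 'M[F]_e) (tw : twisted X H a R) :
  twisted_irr H R -> mx_irreducible (tens_repr tw).
Proof.
case=> e_gt0 irrR; apply/mx_irrP.
split=> [|U modU]; first by rewrite muln_gt0 n_gt0.
case/rowV0Pn => u uU nz_u; rewrite -sub1mx.
have stabU A M : (mxvec M <= U)%MS -> (mxvec (A *m M) <= U)%MS.
  exact: tens_module_mx modU.
pose d : 'cV[F]_n := delta_mx (Ordinal n_gt0) 0.
pose S := kermx (lin1_mx (mxvec \o mulmx d) *m cokermx U).
have inS w : (w <= S)%MS = (mxvec (d *m w) <= U)%MS.
  by rewrite (sameP sub_kermxP eqP) mulmxA mul_rV_lin1 submxE.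
have inS' (c : 'cV_n) w : (w <= S)%MS -> (mxvec (c *m w) <= U)%MS.
  rewrite inS => /(stabU (c *m d^T)); rewrite -mulmxA (mulmxA _ d) trmx_delta.
  by rewrite mul_delta_mx [delta_mx 0 0]mx11_scalar mxE !eqxx mul1mx.
have fullS: row_full S.
  apply: irrR => [h Hh|].
    apply/row_subP => i; rewrite row_mul inS.
    have := row_sub i S; rewrite inS => iSU.
    have := mxmodule_trans modU Hh iSU; rewrite /= kronE.
    move/(stabU (invmx (P h)^T)); rewrite -(mulmxA (P h)^T).
    by rewrite mulKmx ?unitmx_tr ?(pe_unit pe) // mulmxA.
  pose M := vec_mx u; have [k nz_k]: exists k, row k M != 0.
    apply/existsP; apply: contraNT nz_u => /existsPn rows0.
    rewrite -[u]vec_mxK -/M; have ->: M = 0; last by rewrite linear0.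
    by apply/row_matrixP=> k; rewrite row0; apply/eqP/negPn/rows0.
  apply/rowV0Pn; exists (row k M) => //; rewrite inS rowE mulmxA.
  by apply: stabU; rewrite vec_mxK.
apply/row_subP => i; rewrite -[row i _]vec_mxK [vec_mx _]mx_rank1_sum linear_sum.
apply: summx_sub => k _; apply: inS'; exact: submx_full.
Qed.

Lemma irr_twisted e (R : gT -> 'M[F]_e) (tw : twisted X H a R) :
  mx_irreducible (tens_repr tw) -> twisted_irr H R.
Proof.
case/mx_irrP; rewrite muln_gt0 => /andP[_ e_gt0] irr; split=> // S modS nzS.
have: row_full <<kron (1%:M : 'M_n) S>>%MS.
  apply: irr.
    rewrite (eqmx_module _ (genmxE _)); apply/mxmoduleP=> h Hh /=.
    have /submxP[D SD] := modS h Hh.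
    rewrite kronM SD mul1mx -[P h]mulmx1 -kronM; exact: submxMl.
  rewrite -mxrank_eq0 genmxE mxrank_eq0; apply: contra_neq nzS => S0.
  by apply: (kron_injr n_gt0 (unitmx1 F n)); rewrite S0 kron0r.
rewrite -sub1mx genmxE => sub1; rewrite -sub1mx; apply/row_subP=> i.
pose d : 'cV[F]_n := delta_mx (Ordinal n_gt0) 0.
have /submxP[z] := submx_trans (submx1 (mxvec (d *m row i 1%:M))) sub1.
rewrite -[z]vec_mxK kronE => /(can_inj mxvecK)/(congr1 (mulmx d^T)).
rewrite mulmxA trmx_delta mul_delta_mx [delta_mx 0 0]mx11_scalar mxE !eqxx.
by rewrite mul1mx trmx1 mul1mx mulmxA => ->; apply: submxMl.
Qed.

(** The second factor is the space [K] of [X]-homomorphisms [W] from [rX] to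
    [V], on which [h] acts by [W |-> P(h)^-1 W V(h)].  Evaluation from
    [F^n (x) K] to [V] is onto because [V] is simple, and injective because
    matrices on [F^n] separate the terms of a tensor. *)
Lemma tens_decomposition N (V : mx_representation F H N) (B0 : 'M[F]_(n, N)) :
    mx_irreducible V -> B0 != 0 -> {in X, forall x, rX x *m B0 = B0 *m V x} ->
  exists e (R : gT -> 'M[F]_e) (tw : twisted X H a R), mx_rsim (tens_repr tw) V.
Proof.
move=> irrV nzB0 homB0.
(* [w_ c] is the homomorphism with coordinates [c] in the basis [B] of [K]. *)
pose K := (\bigcap_(x in X) kermx (lin_mulmx (rX x) - lin_mulmxr (V x)))%MS.
have inK W : reflect {in X, forall x, rX x *m W = W *m V x} (mxvec W <= K)%MS.
  apply: (iffP sub_bigcapmxP) => homW x Xx.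
    have /sub_kermxP/eqP := homW x Xx; rewrite mulmxBr !mul_vec_lin subr_eq0.
    by move/eqP/(can_inj mxvecK).
  by apply/sub_kermxP; rewrite mulmxBr !mul_vec_lin /= homW // subrr.
move: (row_base K) (row_base_free K) (eq_row_base K).
set e := \rank K => B freeB defB.
pose w_ (c : 'rV[F]_e) := vec_mx (c *m B) : 'M_(n, N).
have w_hom c x : x \in X -> rX x *m w_ c = w_ c *m V x.
  move: x; apply/inK; rewrite vec_mxK; apply: submx_trans (submxMl _ _) _.
  by rewrite defB.
have w_inj c c' : w_ c = w_ c' -> c = c'.
  by move/(can_inj vec_mxK)/(row_free_inj freeB).
have w_onto W : {in X, forall x, rX x *m W = W *m V x} ->
    w_ (mxvec W *m pinvmx B) = W.
  by move/inK=> WK; rewrite /w_ mulmxKpV ?defB // mxvecK.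
pose act h := lin_mx (mulmxr (V h) \o mulmx (invmx (P h))).
pose R h := B *m act h *m pinvmx B.
have actE h c : h \in H -> w_ (c *m R h) = invmx (P h) *m w_ c *m V h.
  move=> Hh; have uP := pe_unit pe Hh.
  have ->: c *m R h = mxvec (invmx (P h) *m w_ c *m V h) *m pinvmx B.
    by rewrite /R !mulmxA -[c *m B]vec_mxK mul_vec_lin.
  apply: w_onto => x Xx.
  have Hx := sXHP Xx.
  have XxJ: (x ^ h^-1)%g \in X.
    by rewrite -mem_conjg (normsP (normal_norm (pe_normal pe))).
  have swap: rX x *m invmx (P h) = invmx (P h) *m rX (x ^ h^-1)%g.
    apply: (canRL (mulKmx uP)); rewrite mulmxA.
    apply: (canLR (mulmxK uP)); rewrite -(pe_right pe) // -(pe_left pe) //.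
    by rewrite -conjgCV.
  rewrite !mulmxA swap -(mulmxA (invmx _) (rX _)) w_hom // -!mulmxA.
  rewrite -[V (x ^ h^-1)%g *m _]repr_mxM ?(sXHP XxJ) // -[V h *m _]repr_mxM //.
  by rewrite -conjgCV.
clearbody R.
have wZ b c : w_ (b *: c) = b *: w_ c by rewrite /w_ -scalemxAl linearZ.
have tw : twisted X H a R.
  split.
  - apply/row_matrixP=> i; rewrite !rowE mulmx1; apply: w_inj.
    by rewrite actE // pe1 repr_mx1 mulmx1 invmx1 mul1mx.
  - move=> g h Hg Hh; apply/row_matrixP=> i; rewrite !rowE; apply: w_inj.
    have [uPg uPh] := (pe_unit pe Hg, pe_unit pe Hh).
    have invPM : a g h *: (invmx (P h) *m invmx (P g)) = invmx (P (g * h)%g).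
      rewrite -[RHS]mulmx1; apply: (canRL (mulKmx (pe_unit pe (groupM Hg Hh)))).
      by rewrite -scalemxAr scalemxAl -(pe_mul pe) // mulmxA mulmxK ?mulmxV.
    rewrite actE ?groupM // -scalemxAr wZ mulmxA !actE // repr_mxM // -invPM.
    by rewrite -!scalemxAl !mulmxA.
  move=> x h Xx Hh; apply/row_matrixP=> i; rewrite !rowE; apply: w_inj.
  have Hx := sXHP Xx.
  rewrite !actE ?groupM // -!mulmxA.
  apply: (canLR (mulKmx (pe_unit pe (groupM Hx Hh)))).
  rewrite (pe_left pe) // repr_mxM // -(mulmxA (rX x)) mulKVmx ?(pe_unit pe) //.
  by rewrite !mulmxA w_hom.
exists e, R, tw.
(* [T] is the evaluation map [c^T (x) w |-> c^T w_(w)]. *)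
pose T := \sum_k lin1_mx (row k \o vec_mx \o mulmxr B \o row k \o vec_mx).
have TE M : mxvec M *m T = \sum_k row k (w_ (row k M)).
  rewrite mulmx_sumr; apply: eq_bigr => k _; rewrite mul_rV_lin1 /=.
  by rewrite mxvecK.
have T1 (c : 'cV_n) (w : 'rV_e) : mxvec (c *m w) *m T = c^T *m w_ w.
  rewrite TE mulmx_sum_row; apply: eq_bigr => k _.
  rewrite row_mul [row k c]mx11_scalar mul_scalar_mx wZ linearZ /=.
  by rewrite !mxE.
have homT : repr_hom (tens_repr tw) V T.
  move=> h Hh; apply: mxvec_ext1 => c w.
  rewrite mulmxA /= [in LHS]mulmxA kronE !mulmxA.
  rewrite -(mulmxA _ w) !T1 actE // trmx_mul trmxK -!mulmxA.
  by rewrite mulKVmx ?(pe_unit pe).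
have nzT : T != 0.
  apply: contraNneq nzB0 => T0; apply/eqP/row_matrixP=> k.
  by rewrite -(w_onto _ homB0) rowE row0 -trmx_delta -T1 T0 mulmx0.
have freeT : row_free T.
  rewrite -kermx_eq0; apply/rowV0P=> u /sub_kermxP uT0.
  pose M := vec_mx u; suff M0 : M = 0 by rewrite -[u]vec_mxK -/M M0 linear0.
  have {}uT0 A : mxvec (A *m M) *m T = 0.
    have [f span_f] := base_span A^T.
    have ->: mxvec (A *m M) = mxvec M *m kron A^T 1%:M.
      by rewrite kronE trmxK mulmx1.
    rewrite span_f -mulmxA mulmx_suml mulmx_sumr big1 // => x Xx.
    rewrite -scalemxAl -(tens_base tw) // homT ?sXHP // -scalemxAr mulmxA.
    by rewrite vec_mxK uT0 mul0mx scaler0.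
  apply/row_matrixP=> k; rewrite row0; apply: w_inj.
  rewrite [RHS]/w_ mul0mx linear0; apply/row_matrixP=> l; rewrite row0.
  by rewrite [LHS]rowE -trmx_delta -T1 rowE mulmxA uT0.
have fullT := repr_hom_row_full irrV homT nzT.
by exists T => //; rewrite -(eqP freeT) (eqP fullT).
Qed.

End Fixed.

End ProjectiveExtension.

Section TwistedMore.

Variables (F : closedFieldType) (gT : finGroupType).
Local Open Scope ring_scope.

(** An explicit isomorphism, so as not to depend on the proofs that make the
    tensor product a representation. *)
Definition tensor_form (H : {group gT}) n (P : gT -> 'M[F]_n) e
    (R : gT -> 'M[F]_e) N (V : mx_representation F H N) : Prop :=
  exists T T', [/\ T *m T' = 1%:M, T' *m T = 1%:M &
    {in H, forall h, kron (P h) (R h) *m T = T *m V h}].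

Lemma tensor_formP (X H : {group gT}) n (rX : mx_representation F X n) P a
    (pe : proj_ext H rX P a) e (R : gT -> 'M[F]_e) (tw : twisted X H a R)
    N (V : mx_representation F H N) :
  tensor_form P R V <-> mx_rsim (tens_repr pe tw) V.
Proof.
split=> [[T [T' [TT' T'T homT]]] | /mx_rsim_hom[T [T' [TT' T'T homT _]]]].
  exact: inv_hom_rsim TT' T'T _.
by exists T, T'.
Qed.

Lemma tens_over (X : {group gT}) n (rX : mx_representation F X n) e :
    (0 < n)%N -> (0 < e)%N ->
  exists2 B : 'M[F]_(n, n * e), B != 0 &
    {in X, forall x, rX x *m B = B *m kron (rX x) 1%:M}.
Proof.
move=> n_gt0 e_gt0; pose w : 'rV[F]_e := delta_mx 0 (Ordinal e_gt0).
pose B := lin1_mx (mxvec \o (mulmxr w \o @trmx F 1 n)).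
have BE (u : 'rV_n) : u *m B = mxvec (u^T *m w) by rewrite mul_rV_lin1.
exists B.
  pose k := Ordinal n_gt0; apply/eqP=> B0.
  have := BE (delta_mx 0 k); rewrite B0 mulmx0 trmx_delta mul_delta_mx.
  move/esym/eqP; rewrite mxvec_eq0 => /eqP/matrixP/(_ k (Ordinal e_gt0))/eqP.
  by rewrite !mxE !eqxx oner_eq0.
move=> x Xx; apply/row_matrixP=> i; rewrite !row_mul !rowE !BE kronE.
by rewrite mulmx1 trmx_mul mulmxA.
Qed.

(** The rows of [I] are a basis of a stable subspace, and [J] is the projection
    on the quotient by it, so [R] is block triangular with diagonal blocks [R1]
    and [R2]. *)
Lemma twisted_reducible (X H : {group gT}) a e (R : gT -> 'M[F]_e) :
    X \subset H -> twisted X H a R -> (0 < e)%N -> ~ twisted_irr H R ->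
  exists e1 e2 (R1 : gT -> 'M[F]_e1) (R2 : gT -> 'M[F]_e2)
    (I : 'M[F]_(e1, e)) (J : 'M[F]_(e, e2)),
  [/\ [/\ e = e1 + e2, e1 < e & e2 < e]%N,
      twisted X H a R1 /\ twisted X H a R2,
      [/\ exists I', I *m I' = 1%:M, exists J', J' *m J = 1%:M & I *m J = 0],
      {in H, forall h, R1 h *m I = I *m R h} &
      {in H, forall h, R h *m J = J *m R2 h}].
Proof.
move=> sXH tw e_gt0 /not_andP[//|/existsNP[S]].
move=> /not_implyP[stabS /not_implyP[nzS /negP nfullS]].
pose e1 := \rank S; pose e2 := \rank S^C%MS.
move: (row_base S) (eq_row_base S) (row_base S^C%MS) (eq_row_base S^C%MS).
rewrite -/e1 -/e2 => I defS C defSC.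
have e1_le : (e1 <= e)%N by rewrite rank_leq_row.
have def_e : (e1 + e2)%N = e by rewrite /e2 mxrank_compl subnKC.
have fullD : row_full (col_mx I C).
  rewrite -sub1mx -addsmxE (eqmxP (_ : (I + C == S + S^C)%MS)).
    by rewrite sub1mx addsmx_compl_full.
  by apply/eqmxP; apply: adds_eqmx.
have [D' D'D] := row_fullP fullD.
have freeD : row_free (col_mx I C) by rewrite /row_free (eqP fullD) -def_e.
have DD' : col_mx I C *m D' = 1%:M.
  have [D'' DD''] := row_freeP freeD.
  by rewrite -[D'](mulmx1) -DD'' (mulmxA D') D'D mul1mx.
move: D'D DD'; rewrite -[D']hsubmxK.
set I' := lsubmx _; set J := rsubmx _; rewrite mul_row_col mul_col_row.
rewrite scalar_mx_block => sumIJ /eq_block_mx[II' IJ _ CJ].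
have stabI h : h \in H -> I *m R h = I *m R h *m I' *m I.
  move=> Hh; have: (I *m R h <= I)%MS.
    by rewrite defS (submx_trans _ (stabS h Hh)) // submxMr // defS.
  by case/submxP=> Z ->; rewrite -(mulmxA Z I) II' mulmx1.
have stabJ h : h \in H -> R h *m J = J *m (C *m R h *m J).
  move=> Hh; rewrite -[R h in LHS]mul1mx -sumIJ !mulmxDl -!mulmxA.
  rewrite (mulmxA I) (stabI h Hh) -!mulmxA IJ !mulmx0 add0r.
  by [].
have one_H := group1 H.
exists e1, e2, (fun h => I *m R h *m I'), (fun h => C *m R h *m J), I, J.
split; [|split; split| |by move=> h Hh; rewrite -stabI
   |by move=> h Hh; rewrite stabJ].
- split=> //; rewrite -def_e; last first.
    by rewrite -[X in (X < _)%N]add0n ltn_add2r lt0n mxrank_eq0.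
  rewrite -[X in (X < _)%N]addn0 ltn_add2l /e2 mxrank_compl subn_gt0.
  by rewrite ltn_neqAle e1_le andbT.
- by rewrite (tw_one tw) mulmx1.
- move=> g h Hg Hh; rewrite -(tw_mul tw Hg Hh) -scalemxAr -scalemxAl.
  by rewrite (mulmxA (I *m R g *m I')) (mulmxA _ I) -stabI // !mulmxA.
- by move=> x h Xx Hh; rewrite (tw_coset tw).
- by rewrite (tw_one tw) mulmx1.
- move=> g h Hg Hh; rewrite -(tw_mul tw Hg Hh) -scalemxAr -scalemxAl.
  by rewrite -!mulmxA (mulmxA C (R h)) -stabJ.
- by move=> x h Xx Hh; rewrite (tw_coset tw).
by split=> //; [exists I' | exists C].
Qed.

Lemma Groth_class_tens_exact (X H : {group gT}) n
    (rX : mx_representation F X n) P a (pe : proj_ext H rX P a)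
    e e1 e2 (R : gT -> 'M[F]_e) (R1 : gT -> 'M[F]_e1) (R2 : gT -> 'M[F]_e2)
    (tw : twisted X H a R) (tw1 : twisted X H a R1) (tw2 : twisted X H a R2)
    (I : 'M[F]_(e1, e)) (J : 'M[F]_(e, e2)) :
    e = (e1 + e2)%N ->
    (exists I', I *m I' = 1%:M) -> (exists J', J' *m J = 1%:M) -> I *m J = 0 ->
    {in H, forall h, R1 h *m I = I *m R h} ->
    {in H, forall h, R h *m J = J *m R2 h} ->
  Groth_class (tens_repr pe tw) =
    Groth_class (tens_repr pe tw1) + Groth_class (tens_repr pe tw2).
Proof.
move=> def_e [I' II'] [J' J'J] IJ homI homJ.
apply: (@Groth_class_exact _ _ _ _ _ _ _ _ _ (kron 1%:M I) (kron 1%:M J)).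
- by move=> h Hh /=; rewrite !kronM mulmx1 mul1mx homI.
- by move=> h Hh /=; rewrite !kronM mulmx1 mul1mx homJ.
- by apply/row_freeP; exists (kron 1%:M I'); rewrite kronM II' mulmx1 kron11.
- by apply/row_fullP; exists (kron 1%:M J'); rewrite kronM J'J mulmx1 kron11.
- by rewrite kronM IJ kron0r.
by rewrite def_e mulnDr.
Qed.

Lemma proj_ext_sub (N G H : {group gT}) d (rN : mx_representation F N d) S b :
  N \subset H -> H \subset G -> proj_ext G rN S b -> proj_ext H rN S b.
Proof.
move=> sNH sHG [nsNG irr uS baseS leftS rightS mulS]; have sub := subsetP sHG.
split=> //; first exact: normalS nsNG.
- by move=> h /sub; apply: uS.
- by move=> x h Nx /sub; apply: leftS.
- by move=> h x /sub Gh; apply: rightS.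
by move=> g h /sub Gg /sub; apply: mulS.
Qed.

Lemma pe_cocycle_coset (N G : {group gT}) d (rN : mx_representation F N d) S b
    (pe : proj_ext G rN S b) x y g h :
  x \in N -> y \in N -> g \in G -> h \in G -> b (x * g)%g (y * h)%g = b g h.
Proof.
move=> Nx Ny Gg Gh; have [nsNG irr uS baseS leftS rightS mulS] := pe.
have sNG := subsetP (normal_sub nsNG); have [Gx Gy] := (sNG x Nx, sNG y Ny).
have Ny': (y ^ g^-1)%g \in N.
  by rewrite memJ_norm ?groupV // (subsetP (normal_norm nsNG)).
have Gy' := sNG _ Ny'.
have eq1 : S (x * g)%g *m S (y * h)%g = b g h *: S (x * g * (y * h))%g.
  rewrite leftS // leftS // -mulmxA (mulmxA (S g)) -rightS // (conjgCV g y).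
  rewrite leftS // -mulmxA mulS // -!scalemxAr mulmxA -repr_mxM //.
  rewrite -leftS ?(groupM Nx Ny') ?(groupM Gg Gh) //.
  by rewrite -(mulgA x) (mulgA (y ^ _)%g) -conjgCV !mulgA.
have [d_gt0 _] := (mx_irrP _).1 irr.
apply: (scale_unitmx_inj d_gt0 (uS (x * g * (y * h))%g _)); first by rewrite !groupM.
by rewrite -mulS ?groupM.
Qed.

End TwistedMore.

Lemma prod_tensor_form (F : closedFieldType) (gT : finGroupType)
    (H : {group gT}) n (P : gT -> 'M[F]_n) e (R : gT -> 'M[F]_e) N
    (V : mx_representation F H N) b (S : mx_representation F H b)
    (S' : gT -> 'M[F]_b) : {in H, S =1 S'} -> tensor_form P R V ->
  tensor_form P (fun h => kron (R h) (S' h)) (prod_repr V S).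
Proof.
move=> eqS [T [T' [TT' T'T homT]]].
have [A [A' [AA' A'A assocA]]] := tprod_kron_assoc F n e b.
exists (A *m tprod T 1%:M)%R, (tprod T' 1%:M *m A')%R; split.
- by rewrite mulmxA -(mulmxA A) -tprodE TT' mulmx1 tprod1 mulmx1.
- by rewrite mulmxA -(mulmxA _ A') A'A mulmx1 -tprodE T'T mulmx1 tprod1.
move=> h Hh; rewrite mulmxA assocA -!mulmxA -!tprodE homT // mulmx1 mul1mx.
by rewrite eqS.
Qed.

Section MoreForms.

Variables (F : closedFieldType) (gT : finGroupType).
Local Open Scope ring_scope.

Lemma tensor_form_sub (K H : {group gT}) (sKH : K \subset H) n
    (P : gT -> 'M[F]_n) e (R : gT -> 'M[F]_e) N (V : mx_representation F H N) :
  tensor_form P R V -> tensor_form P R (subg_repr V sKH).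
Proof.
case=> T [T' [TT' T'T homT]]; exists T, T'; split=> // k Kk.
exact: homT (subsetP sKH k Kk).
Qed.

Lemma twisted_sub (X K H : {group gT}) a e (R : gT -> 'M[F]_e) :
  K \subset H -> twisted X H a R -> twisted X K a R.
Proof.
move=> /subsetP sKH [R1 Rmul Rcoset].
split=> // [g h /sKH Hg /sKH|x h Xx /sKH]; [exact: Rmul | exact: Rcoset].
Qed.

Lemma Groth_class_tens (X H : {group gT}) n (rX : mx_representation F X n) P a
    (pe : proj_ext H rX P a) e (R : gT -> 'M[F]_e) (tw : twisted X H a R)
    N (V : mx_representation F H N) :
  tensor_form P R V -> Groth_class V = Groth_class (tens_repr pe tw).
Proof.
move/(tensor_formP pe tw)=> sim.
exact: Groth_class_rsim (mx_rsim_sym sim).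
Qed.

Lemma twisted_kron (X H : {group gT}) a e (R : gT -> 'M[F]_e)
    (nXH : H \subset 'N(X)) b (S : mx_representation F (H / X)%G b) :
    X \subset H -> twisted X H a R ->
  twisted X H a (fun h => kron (R h) (S (coset X h))).
Proof.
move=> sXH tw; have nXHP := subsetP nXH.
split=> [|g h Hg Hh|x h Xx Hh].
- by rewrite (tw_one tw) morph1 repr_mx1 kron11.
- rewrite kronM -kronZl (tw_mul tw) // morphM ?nXHP // repr_mxM //;
  by rewrite mem_quotient.
by rewrite (tw_coset tw) // (coset_kerl _ Xx).
Qed.

End MoreForms.

(** * The correspondence attached to two projective extensions *)

Section Correspondence.

Variables (F : closedFieldType) (gT : finGroupType) (X A Y B : {group gT}).
Variables (chi : IBr F X) (psi : IBr F Y).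
Local Notation n := (Defs.irr_degree (irrep chi)).
Local Notation m := (Defs.irr_degree (irrep psi)).
Variables (P : gT -> 'M[F]_n) (Q : gT -> 'M[F]_m) (a : gT -> gT -> F).
Hypotheses (peP : proj_ext A (irrep chi) P a) (peQ : proj_ext B (irrep psi) Q a).
Hypotheses (sBA : B \subset A) (defA : A :=: X * B) (defY : Y :=: X :&: B).

Local Open Scope ring_scope.

Section Subgroup.

Variables (H K : {group gT}).
Hypotheses (sXH : X \subset H) (sHA : H \subset A) (defK : K :=: H :&: B).

Let sKH : K \subset H. Proof. by rewrite defK subsetIl. Qed.
Let sKB : K \subset B. Proof. by rewrite defK subsetIr. Qed.
Let sYX : Y \subset X. Proof. by rewrite defY subsetIl. Qed.
Let sYK : Y \subset K. Proof. by rewrite defK defY setSI. Qed.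
Let peH := proj_ext_sub sXH sHA peP.
Let peK := proj_ext_sub sYK sKB peQ.

Lemma coset_meets h : h \in H ->
  exists x k, [/\ x \in X, k \in K & h = (x * k)%g].
Proof.
move=> Hh; have := subsetP sHA h Hh; rewrite defA => /mulsgP[x b Xx Bb def_h].
exists x, b; split=> //; rewrite defK inE Bb andbT.
by rewrite -(groupMl b (subsetP sXH x Xx)) -def_h.
Qed.

Section Restrict.
Variables (e : nat) (R : gT -> 'M[F]_e).
Hypothesis tw : twisted X H a R.

Lemma twisted_res : twisted Y K a R.
Proof.
split=> [|g h Kg Kh|x h Yx Kh]; first exact: tw_one tw.
  by rewrite (tw_mul tw) ?(subsetP sKH).
by rewrite (tw_coset tw) ?(subsetP sYX) ?(subsetP sKH).
Qed.

Lemma twisted_irr_res : twisted_irr H R <-> twisted_irr K R.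
Proof.
split=> -[e_gt0 irr]; split=> // S stabS; apply: irr => h.
  move=> Hh; have [x [k [Xx Kk ->]]] := coset_meets Hh.
  by rewrite (tw_coset tw) ?(subsetP sKH) // stabS.
by move=> Kh; apply: stabS; apply: (subsetP sKH).
Qed.

End Restrict.

Lemma twisted_sim_res e e' (R : gT -> 'M[F]_e) (R' : gT -> 'M[F]_e') :
    twisted X H a R -> twisted X H a R' ->
  twisted_sim H R R' <-> twisted_sim K R R'.
Proof.
move=> tw tw'; split=> -[C [C' [CC' C'C homC]]]; exists C, C'; split=> // h.
  by move=> Kh; apply: homC; apply: (subsetP sKH).
move=> Hh; have [x [k [Xx Kk ->]]] := coset_meets Hh.
by rewrite (tw_coset tw) ?(tw_coset tw') ?(subsetP sKH) // homC.
Qed.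

(** [H / X] and [K / Y] are identified by inclusion; [t h] is a representative in
    [K] of the coset of [h]. *)
Lemma twisted_extend e (R : gT -> 'M[F]_e) : twisted Y K a R ->
  exists R', twisted X H a R' /\ {in K, R' =1 R}.
Proof.
move=> tw; pose t h := repr ((X :* h) :&: B).
have tP h : h \in H -> exists2 x, x \in X & t h = (x * h)%g /\ t h \in K.
  move=> Hh; have [x [k [Xx Kk def_h]]] := coset_meets Hh.
  have /setIP[/rcosetP[y Xy def_t] Bt] : t h \in (X :* h) :&: B.
    apply: (mem_repr k); rewrite inE (subsetP sKB) // andbT.
    by apply/rcosetP; exists x^-1%g; rewrite ?groupV // def_h mulKg.
  exists y => //; split=> //; rewrite defK inE Bt andbT def_t.
  by rewrite groupM // (subsetP sXH).
have coset_t h h' : h \in H -> h' \in K -> (exists2 x, x \in X & h' = x * h)%g ->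
    R (t h) = R h'.
  move=> Hh Kh' [x Xx def_h']; have [y Xy [def_t Kt]] := tP h Hh.
  have def_t' : t h = (y * x^-1 * h')%g by rewrite def_t def_h' -mulgA mulKg.
  rewrite def_t' (tw_coset tw) // defY inE (groupM Xy (groupVr Xx)) /=.
  by rewrite -(groupMr _ (subsetP sKB _ Kh')) -def_t'; apply: (subsetP sKB).
exists (fun h => R (t h)); split; last first.
  move=> k Kk; apply: coset_t; rewrite ?(subsetP sKH) //.
  by exists 1%g; rewrite ?mul1g.
split=> [|g h Hg Hh|x h Xx Hh].
- by rewrite (coset_t 1%g 1%g) ?(tw_one tw) //; exists 1%g; rewrite ?mul1g.
- have [[x Xx [def_g Kg]] [y Xy [def_h Kh]]] := (tP g Hg, tP h Hh).
  rewrite -(pe_cocycle_coset peH Xx Xy) // -def_g -def_h (tw_mul tw) //.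
  symmetry; apply: coset_t; rewrite ?groupM //.
  exists (x * y ^ g^-1)%g.
    apply: groupM => //; rewrite memJ_norm ?groupV //.
    exact: (subsetP (normal_norm (pe_normal peH))).
  by rewrite def_g def_h -(mulgA x (y ^ _)%g) (mulgA (y ^ _)%g) -conjgCV !mulgA.
by rewrite /t rcosetM (rcoset_id Xx).
Qed.

Definition corresponds (i : IBr F H) (j : IBr F K) : Prop :=
  exists e (R : gT -> 'M[F]_e),
  [/\ twisted X H a R, tensor_form P R (irrep i) & tensor_form Q R (irrep j)].

Lemma tens_form_over (N G : {group gT}) (sNG : N \subset G) (zeta : IBr F N) S
    (pe : proj_ext G (irrep zeta) S a) e (R : gT -> 'M[F]_e) i :
  twisted N G a R -> tensor_form S R (irrep i) -> i \in IBr_over sNG zeta.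
Proof.
move=> tw /(tensor_formP pe tw) sim.
have e_gt0: (0 < e)%N.
  have := mx_rsim_irr (mx_rsim_sym sim) (Defs.irr_reprP _).
  by case/(irr_twisted).
apply/(rsim_over sNG zeta sim).
have z_gt0: (0 < Defs.irr_degree (irrep zeta))%N by case/mx_irrP: (pe_irr pe).
have [D nzD homD] := tens_over (irrep zeta) z_gt0 e_gt0.
by exists D => // x Nx; rewrite homD // -(tens_base pe tw).
Qed.

Lemma over_tens_form (N G : {group gT}) (sNG : N \subset G) (zeta : IBr F N) S
    (pe : proj_ext G (irrep zeta) S a) i : i \in IBr_over sNG zeta ->
  exists e (R : gT -> 'M[F]_e), twisted N G a R /\ tensor_form S R (irrep i).
Proof.
case/IBr_overP=> D nzD homD.
have [e [R [tw sim]]] := tens_decomposition pe (Defs.irr_reprP _) nzD homD.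
by exists e, R; split=> //; apply/(tensor_formP pe tw).
Qed.

Lemma corresponds_over (sYK' : Y \subset K) i j : corresponds i j ->
  i \in IBr_over sXH chi /\ j \in IBr_over sYK' psi.
Proof.
case=> e [R [tw formP formQ]]; split; first exact: (tens_form_over sXH peH tw).
exact: (tens_form_over sYK' peK (twisted_res tw)).
Qed.

Lemma corresponds_total i : i \in IBr_over sXH chi -> exists j, corresponds i j.
Proof.
case/(over_tens_form peH)=> e [R [tw formP]].
have irrR : twisted_irr K R.
  apply/(twisted_irr_res tw); apply: (irr_twisted (pe := peH) (tw := tw)).
  apply: mx_rsim_irr (Defs.irr_reprP (irrep i)).
  by apply: mx_rsim_sym; apply/tensor_formP.
have [j simj] := irr_affords (tens_irr peK (twisted_res tw) irrR).
by exists j, e, R; split=> //; apply/(tensor_formP peK (twisted_res tw)).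
Qed.

Lemma corresponds_onto (sYK' : Y \subset K) j :
  j \in IBr_over sYK' psi -> exists i, corresponds i j.
Proof.
case/(over_tens_form peK)=> e [R0 [tw0 formQ]].
have [R [tw eqR]] := twisted_extend tw0.
have irrR0 : twisted_irr K R0.
  apply: (irr_twisted (pe := peK) (tw := tw0)).
  apply: mx_rsim_irr (Defs.irr_reprP (irrep j)).
  by apply: mx_rsim_sym; apply/tensor_formP.
have irrR : twisted_irr H R.
  apply/(twisted_irr_res tw); case: irrR0 => e_gt0 irr; split=> // S stabS.
  by apply: irr => k Kk; rewrite -eqR // stabS.
have [i simi] := irr_affords (tens_irr peH tw irrR).
exists i, e, R; split=> //; first exact/(tensor_formP peH tw).
case: formQ => T [T' [TT' T'T homT]]; exists T, T'; split=> // k Kk.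
by rewrite eqR // homT.
Qed.

Lemma corresponds_functional i j j' :
  corresponds i j -> corresponds i j' -> j = j'.
Proof.
case=> e [R [tw /(tensor_formP peH tw) simP]].
move=> /(tensor_formP peK (twisted_res tw)) simQ.
case=> e' [R' [tw' /(tensor_formP peH tw') simP']].
move=> /(tensor_formP peK (twisted_res tw')) simQ'.
apply: irrep_inj; apply: mx_rsim_trans (mx_rsim_sym simQ) _.
apply: mx_rsim_trans simQ'; apply: twisted_sim_rsim.
apply/(twisted_sim_res tw tw'); apply: (rsim_twisted_sim (pe := peH)).
exact: mx_rsim_trans simP (mx_rsim_sym simP').
Qed.

Lemma corresponds_injective i i' j :
  corresponds i j -> corresponds i' j -> i = i'.
Proof.
case=> e [R [tw /(tensor_formP peH tw) simP]].
move=> /(tensor_formP peK (twisted_res tw)) simQ.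
case=> e' [R' [tw' /(tensor_formP peH tw') simP']].
move=> /(tensor_formP peK (twisted_res tw')) simQ'.
apply: irrep_inj; apply: mx_rsim_trans (mx_rsim_sym simP) _.
apply: mx_rsim_trans simP'; apply: twisted_sim_rsim.
apply/(twisted_sim_res tw tw').
apply: (rsim_twisted_sim (pe := peK) (tw := twisted_res tw)
  (tw' := twisted_res tw')).
exact: mx_rsim_trans simQ (mx_rsim_sym simQ').
Qed.

(** The restriction of a simple module, or its product with another one, is no
    longer simple, so the correspondence is needed for reducible [R].  A block
    triangular form of [R] gives one of [P (x) R] and of [Q (x) R], with blocks
    of the same shape. *)
Lemma corresponds_class (sigma : IBr F H -> IBr F K) :
    {in IBr_over sXH chi, forall i, corresponds i (sigma i)} ->
  forall e (R : gT -> 'M[F]_e) (tw : twisted X H a R),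
  Groth_ext (fun i => Groth_irr (sigma i)) (Groth_class (tens_repr peH tw)) =
    Groth_class (tens_repr peK (twisted_res tw)).
Proof.
move=> sigmaP e; have [k lt_ek] := ubnP e; elim: k => // k IHk in e lt_ek *.
move=> R tw; have [e0 | e_gt0] := posnP e.
  by rewrite !Groth_class0 ?raddf0 // e0 muln0.
have [irrR | redR] := pselect (twisted_irr H R).
  have [i simi] := irr_affords (tens_irr peH tw irrR).
  have form_i : tensor_form P R (irrep i) by apply/(tensor_formP peH tw).
  have over_i := tens_form_over sXH peH tw form_i.
  rewrite (Groth_class_irr simi) Groth_ext_irr.
  have irrR' := (twisted_irr_res tw).1 irrR.
  have [j simj] := irr_affords (tens_irr peK (twisted_res tw) irrR').
  rewrite (Groth_class_irr simj); congr Groth_irr.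
  apply: corresponds_functional (sigmaP i over_i) _.
  by exists e, R; split=> //; apply/(tensor_formP peK (twisted_res tw)).
have [e1 [e2 [R1 [R2 [I [J]]]]]] := twisted_reducible sXH tw e_gt0 redR.
case=> -[def_e lt_e1 lt_e2] [tw1 tw2] [II' JJ' IJ] homI homJ.
rewrite (Groth_class_tens_exact peH tw tw1 tw2 def_e II' JJ' IJ) // raddfD /=.
rewrite IHk ?(leq_trans lt_e1) // IHk ?(leq_trans lt_e2) //.
symmetry; apply: (Groth_class_tens_exact _ _ _ _ def_e II' JJ' IJ) => h Kh.
  by apply: homI; apply: (subsetP sKH).
by apply: homJ; apply: (subsetP sKH).
Qed.

End Subgroup.

End Correspondence.

(** The inverse of the isomorphism from [B / Y] to [X B / X] induced by
    inclusion. *)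
Lemma quotient_meet_isom (gT : finGroupType) (X A Y B : {group gT}) :
    X <| A -> B \subset A -> A :=: X * B -> Y :=: X :&: B ->
  exists2 tau : {morphism (A / X) >-> coset_of Y}, isom (A / X) (B / Y) tau &
    {in B, forall b, tau (coset X b) = coset Y b}.
Proof.
move=> nsXA sBA defA defY; have nXA := subsetP (normal_norm nsXA).
have sBAP := subsetP sBA; have sXA := subsetP (normal_sub nsXA).
have nYB : {subset B <= 'N(Y)}.
  apply/subsetP; rewrite defY normsI ?normG //.
  exact: subset_trans sBA (normal_norm nsXA).
pose t (c : coset_of X) := coset Y (repr (c :&: B)).
have tE : {in B, forall b, t (coset X b) = coset Y b}.
  move=> b Bb; have /setIP[] : repr (coset X b :&: B) \in coset X b :&: B.
    apply: (mem_repr b); rewrite inE Bb andbT val_coset ?nXA ?sBAP //.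
    exact: rcoset_refl.
  rewrite /t; move: (repr _) => r; rewrite val_coset ?nXA ?sBAP //.
  case/rcosetP=> x Xx def_r; rewrite def_r => Bxb.
  by rewrite coset_kerl // defY inE Xx -(groupMr _ Bb).
have cosetB c : c \in A / X -> exists2 b, b \in B & c = coset X b.
  case/morphimP=> h _ Ah ->; move: Ah; rewrite defA => /mulsgP[x b Xx Bb ->].
  by exists b => //; apply: coset_kerl.
have tM : {in A / X &, {morph t : c d / (c * d)%g}}.
  move=> c d /cosetB[b Bb ->] /cosetB[b' Bb' ->].
  by rewrite -morphM ?nXA ?sBAP // !tE ?groupM // morphM ?nYB.
exists (Morphism tM) => //; apply/isomP; split.
  apply/injmP=> c d /cosetB[b Bb ->] /cosetB[b' Bb' ->] /=; rewrite !tE //.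
  move/(rcoset_kercosetP (nYB _ Bb) (nYB _ Bb')); rewrite defY => /rcosetP[y].
  by case/setIP=> Xy _ ->; rewrite coset_kerl.
apply/setP=> z; apply/morphimP/morphimP => [[c _ /cosetB[b Bb ->] ->] | [b _ Bb ->]].
  by exists b; rewrite ?nYB //= tE.
by exists (coset X b); rewrite ?mem_quotient ?sBAP //= tE.
Qed.

Section TripleIso.

Variables (F : closedFieldType) (gT : finGroupType) (X A Y B : {group gT}).
Variables (chi : IBr F X) (psi : IBr F Y).
Variables (P : gT -> 'M[F]_(Defs.irr_degree (irrep chi))).
Variables (Q : gT -> 'M[F]_(Defs.irr_degree (irrep psi))) (a : gT -> gT -> F).
Hypotheses (peP : proj_ext A (irrep chi) P a) (peQ : proj_ext B (irrep psi) Q a).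
Hypotheses (sBA : B \subset A) (defA : A :=: X * B) (defY : Y :=: X :&: B).

Section Tau.

Variable tau : {morphism (A / X) >-> coset_of Y}.
Hypothesis isot : isom (A / X) (B / Y) tau.
Hypothesis tauE : {in B, forall b, tau (coset X b) = coset Y b}.

Let nXA : {subset A <= 'N(X)}.
Proof. exact: subsetP (normal_norm (pe_normal peP)). Qed.
Let nYB : {subset B <= 'N(Y)}.
Proof. exact: subsetP (normal_norm (pe_normal peQ)). Qed.
Let sBAP := subsetP sBA.

Lemma tau_subE (H : {group gT}) : X \subset H -> H \subset A ->
  tau_sub tau H :=: H :&: B.
Proof.
move=> sXH sHA; apply/setP=> k; rewrite inE [RHS]inE.
apply/andP/andP=> [[nYk] | [Hk Bk]].
  rewrite inE => /morphimP[c _ /morphimP[h _ Hh ->]].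
  have [x [b [Xx /setIP[Hb Bb] ->]]] :=
    coset_meets defA sXH sHA (erefl (H :&: B)) Hh.
  rewrite /= coset_kerl // tauE //.
  move/(rcoset_kercosetP nYk (nYB Bb)); rewrite defY => /rcosetP[y].
  case/setIP=> Xy By ->; rewrite !groupM //; exact: (subsetP sXH).
split; first exact: nYB.
have: tau (coset X k) \in (tau @* (H / X))%g.
  by rewrite mem_morphim ?mem_quotient ?sBAP.
by rewrite tauE // inE.
Qed.

(** An arbitrary value is taken off the modules over [chi]. *)
Definition choose_corresponding (H : {group gT}) (i : IBr F H) :
    IBr F (tau_sub tau H) :=
  match pselect (exists j, corresponds P Q a (K := tau_sub tau H) i j) with
  | left ex => sval (cid ex)
  | right _ => sval (cid (IBr_inhabited F (tau_sub tau H)))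
  end.


Section OnSubgroup.

Variable H : {group gT}.
Hypotheses (sXH : X \subset H) (sHA : H \subset A).
Let K := tau_sub tau H.
Let defK : K :=: H :&: B. Proof. exact: tau_subE. Qed.
Let sKH : K \subset H. Proof. by rewrite defK subsetIl. Qed.

Lemma choose_correspondingP :
  {in IBr_over sXH chi, forall i,
    corresponds P Q a i (choose_corresponding i : IBr F K)}.
Proof.
move=> i over_i; rewrite /choose_corresponding.
case: pselect => [ex | []]; first by case: cid.
exact (corresponds_total peP peQ defA defY sHA defK over_i).
Qed.

Lemma choose_corresponding_bij :
  {in IBr_over sXH chi &, injective (@choose_corresponding H)} /\
  @choose_corresponding H @: IBr_over sXH chi =
    IBr_over (sub_tau_sub tau H) psi.
Proof.
split=> [i i' over_i over_i' eq_ii'|].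
  have corr_i := choose_correspondingP over_i; rewrite eq_ii' in corr_i.
  apply: (corresponds_injective peP peQ defA defY sXH sHA defK corr_i).
  exact: choose_correspondingP.
apply/setP=> j; apply/imsetP/idP=> [[i over_i ->] | over_j].
  have corr_i := choose_correspondingP over_i.
  by have [] := corresponds_over peP peQ defY sXH sHA defK
    (sub_tau_sub tau H) corr_i.
have [i corr_ij] := corresponds_onto peP peQ defA defY sXH sHA defK over_j.
have [over_i _] := corresponds_over peP peQ defY sXH sHA defK
  (sub_tau_sub tau H) corr_ij.
exists i => //.
apply: (corresponds_functional peP peQ defA defY sXH sHA defK corr_ij).
exact: choose_correspondingP.
Qed.

Lemma choose_corresponding_class e (R : gT -> 'M[F]_e) N N'
    (V : mx_representation F H N) (W : mx_representation F K N') :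
    twisted X H a R -> tensor_form P R V -> tensor_form Q R W ->
  Groth_ext (fun i => Groth_irr (choose_corresponding i)) (Groth_class V)
    = Groth_class W.
Proof.
move=> tw formV formW.
rewrite (Groth_class_tens (proj_ext_sub sXH sHA peP) tw formV).
rewrite (corresponds_class peP peQ defA defY sHA defK
  choose_correspondingP tw).
by symmetry; apply: Groth_class_tens.
Qed.

End OnSubgroup.


(** Restriction acts on the second tensor factor only. *)
Lemma choose_corresponding_Res (K H : {group gT}) (sXK : X \subset K)
    (sKH : K \subset H) : H \subset A ->
  forall eta, in_Groth_over (subset_trans sXK sKH) chi eta ->
  Groth_ext (fun i => Groth_irr (@choose_corresponding K i))
    (Groth_Res sKH eta) =
  Groth_Res (tau_subS tau sKH)
    (Groth_ext (fun i => Groth_irr (@choose_corresponding H i)) eta).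
Proof.
move=> sHA eta over_eta; rewrite /Groth_Res !Groth_ext_comp.
apply: eq_Groth_ext => i /(in_Groth_over_neq0 over_eta) over_i.
rewrite Groth_ext_irr.
have [e [R [tw formP formQ]]] := choose_correspondingP sHA over_i.
apply: (choose_corresponding_class sXK (subset_trans sKH sHA)
  (twisted_sub sKH tw)).
  exact: tensor_form_sub.
exact: tensor_form_sub.
Qed.

(** A module of [H / X] can be moved to the second tensor factor. *)
Lemma choose_corresponding_tensor (H : {group gT}) (sXH : X \subset H)
    (sHA : H \subset A) (nXH : H \subset 'N(X)) b
    (S : mx_representation F (H / X)%G b) eta : in_Groth_over sXH chi eta ->
  Groth_ext (fun i => Groth_irr (@choose_corresponding H i))
    (Groth_tensor nXH eta S) =
  Groth_tensor (tau_sub_norm tau H)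
    (Groth_ext (fun i => Groth_irr (@choose_corresponding H i)) eta)
    (tau_repr (isom_inj isot) sHA S).
Proof.
move=> over_eta; rewrite /Groth_tensor !Groth_ext_comp.
apply: eq_Groth_ext => i /(in_Groth_over_neq0 over_eta) over_i.
rewrite Groth_ext_irr.
have [e [R [tw formP formQ]]] := choose_correspondingP sHA over_i.
apply: (choose_corresponding_class sXH sHA (twisted_kron nXH S sXH tw)).
  exact: prod_tensor_form formP.
apply: prod_tensor_form formQ => k Kk /=; rewrite /morphim_mx /=; congr (S _).
have := Kk; rewrite (tau_subE sXH sHA) => /setIP[Hk Bk].
rewrite -[coset Y k]tauE // invmE //.
by rewrite mem_quotient ?sBAP.
Qed.

End Tau.

Theorem proj_ext_triple_iso :
  modular_triple A chi -> modular_triple B psi -> modular_triple_iso A chi B psi.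
Proof.
move=> tripleA tripleB; split=> //.
have [tau isot tauE] := quotient_meet_isom (pe_normal peP) sBA defA defY.
exists tau, isot, (choose_corresponding tau); split.
- by move=> H sXH sHA; apply: choose_corresponding_bij.
- by move=> K H sXK sKH sHA eta over_eta; apply: choose_corresponding_Res.
by move=> H sXH sHA nXH eta over_eta beta; apply: choose_corresponding_tensor.
Qed.

End TripleIso.

Lemma modular_triple_iso_card (F : closedFieldType) (gT rT : finGroupType)
    (G N : {group gT}) (theta : IBr F N) (Gamma M : {group rT}) (phi : IBr F M)
    (sNG : N \subset G) (sMGamma : M \subset Gamma) :
  modular_triple_iso G theta Gamma phi ->
  #|IBr_over sNG theta| = #|IBr_over sMGamma phi|.
Proof.
case=> [[nsNG _]] [nsMGamma _] [tau [isot [sigma [bij _ _]]]].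
have [inj_sigma im_sigma] := bij G sNG (subxx G).
rewrite -(card_in_imset inj_sigma) im_sigma.
have defGamma : tau_sub tau G = Gamma.
  apply/group_inj; rewrite /= (isom_im isot) quotientGK //.
move: (sub_tau_sub tau G); rewrite defGamma => sM.
by rewrite (bool_irrelevance sM sMGamma).
Qed.

(** * The Clifford correspondence *)

Section CliffordCorrespondence.

Variables (F : closedFieldType) (gT : finGroupType) (G N : {group gT}).
Hypothesis nsNG : N <| G.
Variable theta : IBr F N.

Local Open Scope ring_scope.

Let T := IBr_stab_group G theta.
Let sNG : N \subset G := normal_sub nsNG.
Let sTG : T \subset G.
Proof. by apply/subsetP=> g; rewrite inE => /andP[/setIP[]]. Qed.

Lemma stab_normal : N \subset T.
Proof.
apply/subsetP=> x Nx; rewrite inE inE (subsetP sNG) // (subsetP (normG N)) //=.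
apply/asboolP/twist_fixesP; split=> [y z _ _|y Ny|]; rewrite ?conjMg ?memJ_norm //.
  exact: (subsetP (normG N)).
exists (irrep theta x^-1%g) => [|y Ny]; first by rewrite repr_mx_unit ?groupV.
by rewrite -!repr_mxM ?groupV ?groupJ // conjgE -!mulgA mulgV mulg1.
Qed.

Lemma stabP g : g \in G -> reflect
  (exists2 B, B \in unitmx &
     {in N, forall x, irrep theta (x ^ g)%g *m B = B *m irrep theta x})
  (g \in T).
Proof.
move=> Gg; have nNg := subsetP (normal_norm nsNG) g Gg.
rewrite inE in_setI Gg nNg /=; apply: (iffP (asboolP _)) => [/twist_fixesP[] // | homB].
apply/twist_fixesP; split=> // [x y _ _|x Nx]; first by rewrite conjMg.
by rewrite memJ_norm.
Qed.

Section OneModule.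

Variables (n : nat) (V : mx_representation F G n).
Hypothesis irrV : mx_irreducible V.
Variable E0 : 'M[F]_(Defs.irr_degree (irrep theta), n).
Hypotheses (nzE0 : E0 != 0) (homE0 : repr_hom (irrep theta) (subg_repr V sNG) E0).

Let VN := subg_repr V sNG.
Let M0 : 'M_n := <<E0>>%MS.

Lemma hom_image_simple E : E != 0 -> repr_hom (irrep theta) VN E ->
  mxsimple VN <<E>>%MS.
Proof.
move=> nzE homE.
have [modE simE] :=
  simple_hom_submod (Defs.irr_reprP (irrep theta)) homE nzE.
apply/(submod_mx_irr modE).
exact: mx_rsim_irr (mx_rsim_sym simE) (Defs.irr_reprP _).
Qed.

Let W0 := component_mx VN M0.

Let simM0 : mxsimple VN M0. Proof. exact: hom_image_simple. Qed.

Lemma hom_sub_component E : repr_hom (irrep theta) VN E -> (E <= W0)%MS.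
Proof.
move=> homE; have [-> | nzE] := eqVneq E 0; first exact: sub0mx.
rewrite -(genmxE E); apply: (mx_iso_component simM0).
have [modE simE] :=
  simple_hom_submod (Defs.irr_reprP (irrep theta)) homE nzE.
have [modE0 simE0] :=
  simple_hom_submod (Defs.irr_reprP (irrep theta)) homE0 nzE0.
apply/(mx_rsim_iso modE0 modE); exact: mx_rsim_trans simE0 (mx_rsim_sym simE).
Qed.

Lemma simple_component_hom U : mxsimple VN U -> (U <= W0)%MS ->
  exists E, [/\ E != 0, repr_hom (irrep theta) VN E & (E :=: U)%MS].
Proof.
move=> simU sUW; have [modU nzU _] := simU.
have [modE0 simE0] :=
  simple_hom_submod (Defs.irr_reprP (irrep theta)) homE0 nzE0.
have isoU := component_mx_iso simM0 simU sUW.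
have sim : mx_rsim (irrep theta) (submod_repr modU).
  by apply: mx_rsim_trans (mx_rsim_sym simE0) _; apply/mx_rsim_iso.
have [D [D' [DD' D'D homD _]]] := mx_rsim_hom sim.
have defE : (val_submod D :=: U)%MS.
  apply/eqmxP; rewrite val_submodP /= -(val_submod1 U) val_submodS -D'D.
  exact: submxMl.
exists (val_submod D); split=> //.
  by apply: contraNneq nzU => E0'; rewrite -submx0 -defE E0' sub0mx.
move=> x Nx; rewrite -[VN x]/(V x) -(val_submodJ modU) // -homD //.
by rewrite val_submodE [RHS]val_submodE mulmxA.
Qed.

Let conjV g x : g \in G -> x \in N -> V g *m V (x ^ g)%g = V x *m V g.
Proof.
move=> Gg Nx; have Gx := subsetP sNG x Nx.
by rewrite -!repr_mxM ?groupJ // -conjgC.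
Qed.

Lemma component_stab g : g \in G -> (W0 *m V g <= W0)%MS = (g \in T).
Proof.
move=> Gg; apply/idP/(stabP Gg) => [sWgW | [B uB homB]].
  have simMg : mxsimple VN (M0 *m V g) by exact: (Clifford_simple simM0 Gg).
  have sMgW : (M0 *m V g <= W0)%MS.
    exact: submx_trans (submxMr _ (component_mx_id simM0)) sWgW.
  have [E [nzE homE defE]] := simple_component_hom simMg sMgW.
  have /submxP[B defB] : (E0 *m V g <= E)%MS.
    by rewrite defE submxMr // genmxE.
  have freeE := repr_hom_row_free (Defs.irr_reprP _) homE nzE.
  have homBg x : x \in N ->
      irrep theta x *m B = B *m irrep theta (x ^ g)%g.
    move=> Nx; have Nxg : (x ^ g)%g \in N.
      by rewrite memJ_norm ?(subsetP (normal_norm nsNG)).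
    apply: (row_free_inj freeE); rewrite -!mulmxA homE // (mulmxA B) -defB.
    by rewrite mulmxA homE0 // -!mulmxA /= conjV.
  have uB : B \in unitmx.
    rewrite -row_free_unit /row_free -(mxrankMfree _ freeE) -defB mxrankMfree.
      exact: (repr_hom_row_free (Defs.irr_reprP _) homE0 nzE0).
    by rewrite row_free_unit repr_mx_unit.
  exists (invmx B) => [|x Nx]; first by rewrite unitmx_inv.
  by rewrite -[LHS](mulKmx uB) (mulmxA B) -homBg // mulmxK.
have [I [U isoU defW]] := component_mx_def simM0; rewrite -/W0 in defW.
rewrite {1}defW sumsmxMr; apply/sumsmx_subP=> i _.
have simU := mx_iso_simple (isoU i) simM0.
have sUW : (U i <= W0)%MS by exact: mx_iso_component (isoU i).
have [E [nzE homE defE]] := simple_component_hom simU sUW.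
rewrite -(eqmxMr (V g) defE).
have <- : invmx B *m (B *m (E *m V g)) = E *m V g by rewrite mulKmx.
apply: submx_trans (submxMl _ _) _; apply: hom_sub_component => x Nx.
have nNg' : g^-1%g \in 'N(N) by rewrite groupV (subsetP (normal_norm nsNG)).
have Ny : (x ^ g^-1)%g \in N by rewrite memJ_norm.
have := homB _ Ny; rewrite conjgKV => homBx.
rewrite mulmxA homBx -!mulmxA (mulmxA (irrep theta _)) homE // -!mulmxA.
by rewrite -[VN _]/(V _) -conjV // conjgKV.
Qed.


(** By Clifford's theorem a homogeneous component is simple for its own
    stabiliser, and the latter is the stabiliser of [theta]. *)
Lemma component_simple : mxsimple (subg_repr V sTG) W0.
Proof.
have defW := PackSocleK (component_socle (DecSocleType VN) simM0).
set W := PackSocle _ in defW; have := Clifford_rstabs_simple irrV W.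
have eqT : rstabs_group V W0 = T.
  apply/group_inj/setP=> g; rewrite inE.
  have [Gg|] := boolP (g \in G); first exact: component_stab.
  by rewrite [in RHS]inE in_setI => /negPf->.
have transfer (R : {group gT}) (sRG : R \subset G) :
    R = T -> mxsimple (subg_repr V sRG) W0 -> mxsimple (subg_repr V sTG) W0.
  move=> eqRT; move: sRG; rewrite eqRT => sRG.
  by rewrite (bool_irrelevance sRG sTG).
by rewrite defW; apply: (transfer (rstabs_group V W0)).
Qed.

(** The projection on the homogeneous component along the other ones. *)
Lemma component_projection : exists p : 'M_n,
  [/\ W0 *m p = W0, (p <= W0)%MS, {in T, forall t, V t *m p = p *m V t} &
      {in G, forall g, g \notin T -> W0 *m V g *m p = 0}].
Proof.
pose sN := DecSocleType VN.
have defW := PackSocleK (component_socle sN simM0).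
set W := PackSocle _ in defW.
pose C := (\sum_(W' : sN | W' != W) W')%MS.
have dxWC : (W :&: C = 0)%MS.
  by have /mxdirect_sumsP/(_ W isT) := Socle_direct sN.
have WC1 : (W + C :=: 1%:M)%MS.
  by rewrite -(Clifford_Socle1 irrV sN) /Socle (bigD1 W).
have moveC (W' : sN) g : g \in G ->
    ~~ (W' *m V g <= W)%MS -> (W' *m V g <= C)%MS.
  move=> Gg nsub.
  have [W1 defW1] : exists W1 : sN, (W1 :=: W' *m V g)%MS.
    by eexists; apply: (val_Clifford_act W' Gg).
  rewrite -defW1; apply: (sumsmx_sup W1) => //.
  by apply: contraNneq nsub => eqW; rewrite -defW1 eqW.
have stabW t : t \in T -> (W *m V t <= W)%MS.
  by move=> Tt; rewrite defW component_stab ?(subsetP sTG).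
have stabC t : t \in T -> (C *m V t <= C)%MS.
  move=> Tt; have Gt := subsetP sTG t Tt; rewrite sumsmxMr.
  apply/sumsmx_subP=> W' neW; apply: moveC => //.
  apply/negP => sW'; have sub' : (W' <= W)%MS.
    rewrite -(repr_mxK V Gt W'); apply: submx_trans (submxMr _ sW') _.
    by apply: stabW; rewrite groupV.
  have /negP[] := nz_socle W'; rewrite -submx0 -dxWC sub_capmx sub' /=.
  exact: (sumsmx_sup W').
exists (proj_mx W C); split.
- by rewrite /W0 -defW proj_mx_id.
- by rewrite /W0 -defW -[proj_mx _ _]mul1mx proj_mx_sub.
- move=> t Tt; have modT U : {in T, forall t, (U *m V t <= U)%MS} ->
      mxmodule (subg_repr V sTG) U by move=> stabU; apply/mxmoduleP.
  have := proj_mx_hom dxWC (modT _ W stabW) (modT _ C stabC).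
  rewrite WC1 => /hom_mxP/(_ t Tt); by rewrite !mul1mx.
move=> g Gg nTg; rewrite /W0 -defW proj_mx_0 // moveC //.
by rewrite defW component_stab.
Qed.


(** The homogeneous component determines the module: extend a homomorphism
    defined on it by zero on the other components, and sum its conjugates over
    the cosets of the stabiliser. *)
Lemma hom_from_component n' (V' : mx_representation F G n')
    (modW : mxmodule (subg_repr V sTG) W0) (D : 'M[F]_(\rank W0, n')) :
    mx_irreducible V' -> D != 0 ->
    repr_hom (submod_repr modW) (subg_repr V' sTG) D ->
  mx_rsim V V'.
Proof.
move=> irrV' nzD homD; have [p [W0p sub_p homp killp]] := component_projection.
have sTGP := subsetP sTG.
pose f := in_submod W0 p *m D.
have homf t : t \in T -> V t *m f = f *m V' t.
  move=> Tt; have homDt : submod_repr modW t *m D = D *m V' t by apply: homD.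
  rewrite /f mulmxA -(mulmxA (in_submod _ _) D) -homDt.
  rewrite (mulmxA (in_submod _ _)); congr (_ *m D).
  by rewrite -in_submodM homp // -(in_submodJ modW).
have nzW0f : W0 *m f != 0.
  apply: contraNneq nzD => W0f0; rewrite -submx0.
  apply: submx_trans (_ : D <= W0 *m f)%MS _; last by rewrite W0f0 sub0mx.
  rewrite /f mulmxA -in_submodM W0p -[X in (X <= _)%MS]mul1mx submxMr //.
  by rewrite -val_submodS in_submodK // val_submod1.
have killf g : g \in G -> g \notin T -> W0 *m V g *m f = 0.
  by move=> Gg nTg; rewrite /f mulmxA -in_submodM killp // linear0 mul0mx.
clearbody f; pose phi g := V g^-1%g *m f *m V' g.
have phiT t g : t \in T -> g \in G -> phi (t * g)%g = phi g.
  move=> Tt Gg; have Gt := sTGP t Tt.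
  rewrite /phi invMg !repr_mxM ?groupV // -!mulmxA; congr (_ *m _).
  rewrite (mulmxA f) -homf // -(mulmxA (V t)) mulmxA -repr_mxM ?groupV //.
  by rewrite mulVg repr_mx1 mul1mx.
pose Phi := \sum_(K in rcosets T G) phi (repr K).
have repr_in K : K \in rcosets T G -> exists2 g, g \in G & K = T :* g.
  by move/rcosetsP.
have phi_repr g : g \in G -> phi (repr (T :* g)) = phi g.
  by move=> Gg; have [t Tt ->] := rcosetP (mem_repr_rcoset T g); rewrite phiT.
have homPhi g : g \in G -> V g *m Phi = Phi *m V' g.
  move=> Gg; suff eqPhi : Phi = V g^-1%g *m Phi *m V' g.
    by rewrite {1}eqPhi !mulmxA -repr_mxM ?groupV // mulgV repr_mx1 mul1mx.
  rewrite mulmx_sumr mulmx_suml {1}/Phi (reindex_inj (rcoset_inj (x := g))) /=.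
  have memR (K : {set gT}) : (K :* g \in rcosets T G) = (K \in rcosets T G).
    apply/rcosetsP/rcosetsP => -[h Gh defK].
      by exists (h * g^-1)%g; rewrite ?groupM ?groupV // rcosetM -defK rcosetK.
    by exists (h * g)%g; rewrite ?groupM // rcosetM defK.
  apply: eq_big => [K | K]; first exact: memR.
  rewrite memR => /repr_in[h Gh ->].
  rewrite -rcosetM !phi_repr ?groupM // /phi invMg !repr_mxM ?groupV //.
  by rewrite !mulmxA.
have nzPhi : Phi != 0.
  apply: contraNneq nzW0f => Phi0; have := congr1 (mulmx W0) Phi0.
  rewrite mulmx0 /Phi (bigD1 (gval T)) /=; last first.
    by apply/rcosetsP; exists 1%g; rewrite ?mulg1.
  rewrite mulmxDr mulmx_sumr big1 => [|K /andP[/repr_in[g Gg ->] neT]].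
    rewrite addr0 -[X in repr X]mulg1 phi_repr // /phi.
    by rewrite invg1 !repr_mx1 mulmx1 mul1mx => ->.
  rewrite phi_repr // /phi !mulmxA.
  rewrite killf ?mul0mx ?groupV //.
  by apply: contra neT => Tg; rewrite rcoset_id.
exact: repr_hom_rsim irrV irrV' homPhi nzPhi.
Qed.

(** The image of [U] is generated by a submodule affording [theta], so it lies
    in the homogeneous component; the latter is simple. *)
Lemma component_rsim (modW : mxmodule (subg_repr V sTG) W0)
    m (U : mx_representation F T m) (E : 'M[F]_(_, m)) (D : 'M[F]_(m, n)) :
    mx_irreducible U -> E != 0 ->
    repr_hom (irrep theta) (subg_repr U stab_normal) E ->
    D != 0 -> repr_hom U (subg_repr V sTG) D ->
  mx_rsim U (submod_repr modW).
Proof.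
move=> irrU nzE homE nzD homD; have sTGP := subsetP sTG.
have sDW : (D <= W0)%MS.
  pose S := (\sum_(t in T) <<E *m U t>>)%MS.
  have modS : mxmodule U S.
    apply/mxmoduleP=> t Tt; rewrite sumsmxMr; apply/sumsmx_subP=> u Tu.
    apply: (sumsmx_sup (u * t)%g); first exact: groupM.
    by rewrite (eqmxMr _ (genmxE _)) genmxE repr_mxM // mulmxA.
  have nzS : S != 0.
    apply: contraNneq nzE => S0; rewrite -submx0 -S0.
    by apply: (sumsmx_sup 1%g) => //; rewrite genmxE repr_mx1 mulmx1.
  have fullS : row_full S by have /mx_irrP[_] := irrU; apply.
  apply: submx_trans (_ : D <= S *m D)%MS _.
    by rewrite -[X in (X <= _)%MS]mul1mx submxMr // sub1mx.
  rewrite /S sumsmxMr_gen; apply/sumsmx_subP=> t Tt.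
  rewrite genmxE (eqmxMr _ (genmxE _)) -mulmxA homD // mulmxA.
  have homED : repr_hom (irrep theta) VN (E *m D).
    by move=> x Nx; rewrite mulmxA homE // -!mulmxA homD // (subsetP stab_normal).
  apply: submx_trans (submxMr _ (hom_sub_component homED)) _.
  by rewrite component_stab ?sTGP.
apply: (repr_hom_rsim (B := in_submod W0 D)) => //.
- by apply/submod_mx_irr; apply: component_simple.
- by move=> t Tt; rewrite -(in_submodJ modW) // -homD // in_submodM.
by apply: contraNneq nzD => D0; rewrite -[D](in_submodK sDW) D0 linear0.
Qed.

End OneModule.

(** Map [U] to the regular module of [G] by [u |-> sum_t (u t^-1 c) t], with [c]
    a linear form, and take the first term of a composition series that
    contains the image: the corresponding factor is the simple module sought. *)
Lemma embed_in_restriction (H : {group gT}) (sHG : H \subset G)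
    m (U : mx_representation F H m) : mx_irreducible U ->
  exists (i : IBr F G) (D : 'M[F]_(m, _)),
    D != 0 /\ repr_hom U (subg_repr (irrep i) sHG) D.
Proof.
move=> irrU; have [m_gt0 _] := (mx_irrP _).1 irrU.
pose aG := regular_repr F G; pose c : 'cV[F]_m := delta_mx (Ordinal m_gt0) 0.
pose D0 := \sum_(t in H) U t^-1%g *m c *m delta_mx 0 (gring_index G t).
have homD0 : repr_hom U (subg_repr aG sHG) D0.
  move=> u Hu; rewrite mulmx_sumr mulmx_suml.
  rewrite (reindex_inj (mulIg u)) /=; apply: eq_big => [t | t]; first exact: groupMr.
  rewrite groupMr // => Ht; have [Gt Gu] := (subsetP sHG t Ht, subsetP sHG u Hu).
  rewrite !mulmxA -repr_mxM ?groupV ?groupM // invMg mulgA mulgV mul1g.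
  by rewrite -[RHS]mulmxA; congr (_ *m _); rewrite -rowE rowK gring_indexK.
have nzD0 : D0 != 0.
  apply/eqP=> /(congr1 (mulmxr (delta_mx (gring_index G 1) 0 : 'cV_(gcard G)))) /=.
  rewrite mul0mx mulmx_suml (bigD1 1%g) //= big1 => [|t /andP[Ht net]].
    rewrite addr0 invg1 repr_mx1 mul1mx -mulmxA mul_delta_mx mul_delta_mx.
    by move/matrixP/(_ (Ordinal m_gt0) 0)/eqP; rewrite !mxE !eqxx oner_eq0.
  rewrite -(mulmxA _ (delta_mx 0 (gring_index G t))) mul_delta_mx_cond.
  case: eqP => [eq_t1 | _]; last by rewrite mulr0n mulmx0.
  have Gt := subsetP sHG t Ht; case/eqP: net.
  by rewrite -[t](gring_indexK (G := G)) ?eq_t1 ?gring_indexK.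
have [C [compC lastC]] : exists C, mx_composition_series aG C /\ (last 0 C :=: 1%:M)%MS.
  exact: compseries_exists.
have exk : exists k, (D0 <= (0 :: C)`_k)%MS.
  by exists (size C); rewrite -last_nth lastC submx1.
case: (ex_minnP exk) => -[|k] sD0 min_k.
  have : (D0 <= (0 : 'M_(gcard G)))%MS := sD0; by rewrite submx0 (negPf nzD0).
have lt_k : (k < size C)%N by apply: min_k; rewrite -last_nth lastC submx1.
have irr_k := mx_series_repr_irr compC lt_k.
have [i /mx_rsim_hom[B [B' [BB' B'B homB _]]]] := irr_affords irr_k.
pose U1 := (0 :: C)`_k; pose UV := <<in_factmod U1 C`_k>>%MS.
have modU1 : mxmodule aG U1 := mx_subseries_module' k (proj1 compC).
pose D1 := in_submod UV (in_factmod U1 D0).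
have sD1 : (in_factmod U1 D0 <= UV)%MS by rewrite genmxE submxMr.
have homD1 : repr_hom U (subg_repr (series_repr k compC) sHG) D1.
  move=> u Hu; have Gu := subsetP sHG u Hu; rewrite /D1 -in_submodM -in_factmodM.
  rewrite homD0 // -[subg_repr aG sHG u]/(aG u) (in_factmodJ modU1) //.
  have modCk := mx_subseries_module k (proj1 compC).
  by rewrite (in_submodJ (section_module modU1 modCk)).
have nzD1 : D1 != 0.
  apply/eqP=> D10; suff /min_k : (D0 <= (0 :: C)`_k)%MS by rewrite ltnn.
  by rewrite -in_factmod_eq0 -(in_submodK sD1) -/D1 D10 linear0.
clearbody D1; exists i, (D1 *m B); split.
  by apply: contraNneq nzD1 => D1B0; rewrite -[D1]mulmx1 -BB' mulmxA D1B0 mul0mx.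
move=> u Hu; rewrite mulmxA homD1 // -!(mulmxA D1); congr (_ *m _).
exact: homB (subsetP sHG u Hu).
Qed.

Let below (i : IBr F G) (j : IBr F T) : Prop :=
  j \in IBr_over stab_normal theta /\
  exists2 D : 'M[F]_(_, _), D != 0 & repr_hom (irrep j) (subg_repr (irrep i) sTG) D.

Let below_over i j : below i j -> i \in IBr_over sNG theta.
Proof.
case=> /IBr_overP[E nzE homE] [D nzD homD]; apply/IBr_overP; exists (E *m D).
  have freeD := repr_hom_row_free (Defs.irr_reprP (irrep j)) homD nzD.
  by rewrite -mxrank_eq0 mxrankMfree // mxrank_eq0.
move=> x Nx; rewrite mulmxA homE // -!mulmxA homD //.
exact: (subsetP stab_normal).
Qed.

Let below_component i j E0 (nzE0 : E0 != 0)
    (homE0 : repr_hom (irrep theta) (subg_repr (irrep i) sNG) E0) modW :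
  below i j ->
  mx_rsim (irrep j) (@submod_repr _ _ _ _ (subg_repr (irrep i) sTG)
    (component_mx (subg_repr (irrep i) sNG) <<E0>>%MS) modW).
Proof.
case=> /IBr_overP[E nzE homE] [D nzD homD].
exact: (component_rsim (Defs.irr_reprP _) nzE0 homE0 modW (Defs.irr_reprP _)
  nzE homE nzD homD).
Qed.

Let below_total i : i \in IBr_over sNG theta -> exists j, below i j.
Proof.
case/IBr_overP=> E0 nzE0 homE0.
have simW := component_simple (Defs.irr_reprP _) nzE0 homE0.
have modW := mxsimple_module simW.
have [j simj] := irr_affords ((submod_mx_irr modW).2 simW).
have subE0 := hom_sub_component nzE0 homE0 homE0.
exists j; split.
  apply/(rsim_over stab_normal theta simj).
  exists (in_submod (component_mx (subg_repr (irrep i) sNG) <<E0>>%MS) E0).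
    by apply: contraNneq nzE0 => E00; rewrite -(in_submodK subE0) E00 linear0.
  move=> x Nx; rewrite /= -(in_submodJ modW) ?(subsetP stab_normal) // -in_submodM.
  by congr in_submod; apply: homE0.
have [B [B' [BB' B'B _ homB']]] := mx_rsim_hom simj.
have [d_gt0 _] := (mx_irrP _).1 (Defs.irr_reprP (irrep j)).
exists (val_submod B').
  rewrite val_submod_eq0; apply: contraTneq d_gt0 => B'0.
  by rewrite -(mxrank1 F (Defs.irr_degree _)) -B'B B'0 mul0mx mxrank0.
move=> t Tt; rewrite -(val_submodJ modW) // -val_submodM; congr val_submod.
exact: homB'.
Qed.

Let below_functional i j j' : below i j -> below i j' -> j = j'.
Proof.
move=> below_ij below_ij'; have /IBr_overP[E0 nzE0 homE0] := below_over below_ij.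
have modW := mxsimple_module (component_simple (Defs.irr_reprP _) nzE0 homE0).
apply: irrep_inj.
apply: mx_rsim_trans (below_component nzE0 homE0 modW below_ij) _.
exact: mx_rsim_sym (below_component nzE0 homE0 modW below_ij').
Qed.

Let below_injective i i' j : below i j -> below i' j -> i = i'.
Proof.
move=> below_ij below_i'j; have /IBr_overP[E0 nzE0 homE0] := below_over below_ij.
have modW := mxsimple_module (component_simple (Defs.irr_reprP _) nzE0 homE0).
have [B [B' [BB' B'B _ homB']]] :=
  mx_rsim_hom (below_component nzE0 homE0 modW below_ij).
have [_ [D nzD homD]] := below_i'j.
apply: irrep_inj.
apply: (hom_from_component (Defs.irr_reprP _) nzE0 homE0 (D := B' *m D)
  (Defs.irr_reprP _)).
  by apply: contraNneq nzD => B'D0; rewrite -[D]mul1mx -BB' -mulmxA B'D0 mulmx0.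
by move=> t Tt; rewrite mulmxA homB' // -!mulmxA homD.
Qed.

Let below_onto j : j \in IBr_over stab_normal theta -> exists i, below i j.
Proof.
move=> over_j.
have [i [D [nzD homD]]] := embed_in_restriction sTG (Defs.irr_reprP (irrep j)).
by exists i; split=> //; exists D.
Qed.

(** The homogeneous component of [theta] is a simple module of the stabiliser
    that determines the module of [G], and every simple module over [theta] of
    the stabiliser embeds in, so is, such a component. *)
Theorem Clifford_correspondence :
  #|IBr_over stab_normal theta| = #|IBr_over sNG theta|.
Proof.
have [f fP] : exists f, {in IBr_over sNG theta, forall i, below i (f i)}.
  have ex i : exists j, i \in IBr_over sNG theta -> below i j.
    have [/below_total[j ?]|nover] := boolP (i \in IBr_over sNG theta).
      by exists j.
    by have [j _] := IBr_inhabited F T; exists j.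
  by exists (fun i => sval (cid (ex i))) => i; case: cid.
have injf : {in IBr_over sNG theta &, injective f}.
  move=> i i' over_i over_i' eqf; apply: below_injective (fP i over_i) _.
  by rewrite eqf; apply: fP.
rewrite -(card_in_imset injf); congr #|pred_of_set _|.
apply/setP=> j; apply/idP/imsetP=> [/below_onto[i below_ij] | [i over_i ->]].
  have over_i := below_over below_ij; exists i => //.
  exact: below_functional below_ij (fP i over_i).
by case: (fP i over_i).
Qed.

End CliffordCorrespondence.

(** * Projective extensions from the cohomological condition *)

Section Renormalise.

Variables (F : closedFieldType) (gT : finGroupType) (X A : {group gT}).
Variables (n : nat) (rX : mx_representation F X n).
Variables (S : gT -> 'M[F]_n) (c : gT -> gT -> F) (mu : gT -> F) (t : gT -> gT).

Local Open Scope ring_scope.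

(** What the cohomological condition provides: a projective representation that
    lifts, only up to the scalars [mu], the action of [X]. *)
Record proj_lift : Prop := ProjLift {
  pl_normal : X <| A;
  pl_irr : mx_irreducible rX;
  pl_one : S 1%g = 1%:M;
  pl_unit : {in A, forall g, S g \in unitmx};
  pl_mul : {in A &, forall g h, S g *m S h = c g h *: S (g * h)%g};
  pl_base : {in X, forall x, S x = mu x *: rX x}
}.

Hypothesis pl : proj_lift.

Let sXA : {subset X <= A}. Proof. exact: subsetP (normal_sub (pl_normal pl)). Qed.
Let n_gt0 : (0 < n)%N. Proof. by case/mx_irrP: (pl_irr pl). Qed.
Let unit_neq0 (M : 'M[F]_n) (uM : M \in unitmx) := unitmx_neq0 n_gt0 uM.

Let XJ x g : x \in X -> g \in A -> (x ^ g^-1)%g \in X.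
Proof.
move=> Xx Ag.
by rewrite memJ_norm ?groupV ?(subsetP (normal_norm (pl_normal pl))).
Qed.

Lemma pl_cocycle_neq0 g h : g \in A -> h \in A -> c g h != 0.
Proof.
move=> Ag Ah; have := pl_mul pl Ag Ah; apply: contra_eqN => /eqP->.
by rewrite scale0r unit_neq0 // unitmx_mul !(pl_unit pl).
Qed.

Lemma pl_mu_neq0 x : x \in X -> mu x != 0.
Proof.
move=> Xx; have := unit_neq0 (pl_unit pl (sXA Xx)).
by apply: contraNneq => mu0; rewrite (pl_base pl Xx) mu0 scale0r.
Qed.

(** The scalar by which [S g] fails to intertwine [rX] and its conjugate.  It
    only involves the cocycle and [mu], so it is the same for two projective
    representations that share these. *)
Definition twist_scalar g x :=
  c g x * mu (x ^ g^-1)%g / (c (x ^ g^-1)%g g * mu x).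

Lemma twist_scalarP g x : g \in A -> x \in X ->
  S g *m rX x = twist_scalar g x *: (rX (x ^ g^-1)%g *m S g).
Proof.
move=> Ag Xx; have [Ax Xxg] := (sXA Xx, XJ Xx Ag).
have mux := pl_mu_neq0 Xx; have cg := pl_cocycle_neq0 (sXA Xxg) Ag.
have eqS : c (x ^ g^-1)%g g *: (S g *m S x) = c g x *: (S (x ^ g^-1)%g *m S g).
  rewrite (pl_mul pl) // (pl_mul pl (sXA Xxg) Ag) -conjgCV !scalerA.
  by congr (_ *: _); rewrite mulrC.
move: eqS; rewrite (pl_base pl Xx) (pl_base pl Xxg) -scalemxAr -scalemxAl !scalerA => eqS.
apply: (scalerI (a := c (x ^ g^-1)%g g * mu x)); first by rewrite mulf_neq0.
rewrite eqS scalerA /twist_scalar; congr (_ *: _).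
by rewrite [RHS]mulrC divfK // mulf_neq0.
Qed.

Hypothesis twist1 : {in A & X, forall g x, twist_scalar g x = 1}.
Hypothesis tP : {in A, forall g, t g \in A /\ (g * (t g)^-1)%g \in X}.
Hypotheses (tX : {in X & A, forall x g, t (x * g)%g = t g}) (t1 : t 1%g = 1%g).

Definition renorm g := rX (g * (t g)^-1)%g *m S (t g).

Definition renorm_cocycle g h :=
  let y := (t g * t h * (t (g * h))^-1)%g in
  c (t g) (t h) / c y (t (g * h)%g) * mu y.

(** Only the values of [S] on the transversal [t] are kept; the others are
    imposed by translation by [X]. *)
Lemma renorm_proj_ext : proj_ext A rX renorm renorm_cocycle.
Proof.
have conjS g x : g \in A -> x \in X -> S g *m rX x = rX (x ^ g^-1)%g *m S g.
  by move=> Ag Xx; rewrite twist_scalarP // twist1 // scale1r.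
have leftR x g : x \in X -> g \in A -> renorm (x * g)%g = rX x *m renorm g.
  move=> Xx Ag; have [_ Xg] := tP Ag.
  by rewrite /renorm tX // -mulgA (repr_mxM rX Xx Xg) mulmxA.
split=> //.
- exact: pl_normal pl.
- exact: pl_irr pl.
- move=> g Ag; have [At Xt] := tP Ag.
  by rewrite unitmx_mul repr_mx_unit // (pl_unit pl).
- move=> x Xx; rewrite -[x in LHS]mulg1 leftR // /renorm t1 invg1 mulg1.
  by rewrite repr_mx1 mul1mx (pl_one pl) mulmx1.
- move=> g x Ag Xx; have [At Xt] := tP Ag.
  rewrite conjgCV leftR ?XJ // /renorm -mulmxA conjS // !mulmxA -!repr_mxM ?XJ //.
  by rewrite !conjgE; congr (rX _ *m _); rewrite !invgK !mulgA !mulgKV.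
move=> g h Ag Ah; have [[At Xt] [Au Xu]] := (tP Ag, tP Ah).
have Agh := groupM Ag Ah; have [Av Xv] := tP Agh.
set u := t g in At Xt *; set v := t h in Au Xu *.
set w := t (g * h)%g in Av Xv *.
rewrite /renorm_cocycle -/u -/v -/w; set y := (u * v * w^-1)%g.
have Xy : y \in X.
  have nX := subsetP (normal_norm (pl_normal pl)).
  have coset_t k : k \in A -> coset_morphism X (t k) = coset_morphism X k.
    move=> Ak; have [Atk Xtk] := tP Ak; rewrite -{2}[k](mulgKV (t k)).
    by symmetry; apply: coset_kerl.
  apply: coset_idr; first by rewrite nX ?groupM ?groupV.
  rewrite !morphM ?morphV ?groupM ?groupV ?nX // /u /v /w !coset_t //.
  by rewrite morphM ?nX // mulgV.
have Ay := sXA Xy.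
have S_uv : S (u * v)%g = (c y w)^-1 * mu y *: (rX y *m S w).
  have := pl_mul pl Ay Av; rewrite mulgKV => eqS.
  rewrite -scalerA [mu y *: _]scalemxAl -(pl_base pl Xy) eqS scalerA.
  by rewrite mulVf ?scale1r // pl_cocycle_neq0.
rewrite /renorm -/u -/v -/w -mulmxA (mulmxA (S u)) conjS // !mulmxA.
rewrite -(repr_mxM rX Xt (XJ Xu At)).
rewrite -mulmxA (pl_mul pl) // -scalemxAr S_uv -scalemxAr scalerA mulrA mulmxA.
rewrite -(repr_mxM rX (groupM Xt (XJ Xu At)) Xy).
have -> // : (g * u^-1 * (h * v^-1) ^ u^-1 * y = g * h * w^-1)%g.
by rewrite conjgE /y invgK !mulgA !mulgKV.
Qed.

End Renormalise.

Section TwistTrivial.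

Variables (F : closedFieldType) (gT : finGroupType) (X A Z : {group gT}).
Variables (n : nat) (rX : mx_representation F X n).
Variables (S : gT -> 'M[F]_n) (c : gT -> gT -> F) (mu : gT -> F).
Hypothesis pl : proj_lift A rX S c mu.
Hypotheses (defX : X :=: X^`(1) * Z) (cAZ : A \subset 'C(Z)).
Local Open Scope ring_scope.
Hypothesis scalZ : {in Z, forall z, is_scalar_mx (rX z)}.

(** For fixed [g] the scalar is a linear character of [X], so it is trivial on
    the derived subgroup; it is trivial on [Z] because [g] centralises [Z]. *)
Lemma twist_scalar_trivial : {in A & X, forall g x, twist_scalar c mu g x = 1}.
Proof.
move=> g x Ag; pose f := twist_scalar c mu g.
have [nsXA irrX _ uS _ _] := pl; have uSg := uS g Ag.
have n_gt0 : (0 < n)%N by case/mx_irrP: irrX.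
have fP y := twist_scalarP pl Ag (x := y); rewrite -/f in fP.
have XJ y : y \in X -> (y ^ g^-1)%g \in X.
  by move=> Xy; rewrite memJ_norm ?groupV ?(subsetP (normal_norm nsXA)).
have scal_inj a b y : y \in X ->
    a *: (rX (y ^ g^-1)%g *m S g) = b *: (rX (y ^ g^-1)%g *m S g) -> a = b.
  move=> Xy; apply: scale_unitmx_inj n_gt0 _ _ _.
  by rewrite unitmx_mul uSg repr_mx_unit ?XJ.
have f1 : f 1%g = 1.
  apply: (scal_inj _ _ 1%g) => //; rewrite -fP // conj1g repr_mx1 mulmx1.
  by rewrite scale1r mul1mx.
have fM : {in X &, {morph f : y z / (y * z)%g >-> y * z}}.
  move=> y z Xy Xz; apply: (scal_inj _ _ (y * z)%g); first exact: groupM.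
  rewrite -fP ?groupM // conjMg (repr_mxM rX Xy Xz) (repr_mxM rX (XJ y Xy) (XJ z Xz)).
  rewrite mulmxA fP // -scalemxAl -(mulmxA _ (S g)) fP // -scalemxAr.
  by rewrite scalerA mulmxA.
have reprf : mx_repr X (fun y => (f y)%:M : 'M_1).
  by split=> [|y z Xy Xz]; rewrite ?f1 // fM // scalar_mxM.
have f_der y : y \in X^`(1)%g -> f y = 1.
  move/(subsetP (rker_linear (MxRepresentation reprf) (erefl _))).
  by rewrite inE mul1mx => /andP[_ /eqP/matrixP/(_ 0 0)]; rewrite !mxE eqxx.
have sXX := subsetP (der_sub 1 X).
have sZX : {subset Z <= X} by apply/subsetP; rewrite defX mulG_subr.
have f_Z z : z \in Z -> f z = 1.
  move=> Zz; apply: (scal_inj _ _ z (sZX z Zz)); rewrite -fP ?sZX // scale1r.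
  have -> : (z ^ g^-1)%g = z.
    apply/conjg_fixP/commgP/commuteV/commute_sym.
    exact: (centsP cAZ).
  by have /is_scalar_mxP[a ->] := scalZ Zz; rewrite scalar_mxC.
rewrite {1}defX => /mulsgP[y z Yy Zz ->].
by rewrite -/(f _) fM ?(sXX y) ?sZX // f_der // f_Z // mulr1.
Qed.

End TwistTrivial.

Section Pullback.

Variables (F : closedFieldType) (gT : finGroupType) (D S S' A Z : {group gT}).
Variables (theta : IBr F S) (theta' : IBr F S') (sS'S : S' \subset S).
Variables (C : {set {perm gT}}) (d : nat) (P : proj_repr F C d).
Variables (L : mx_representation F S' d) (s : coset_of Z -> gT).
Hypotheses (res : affords (subg_repr (irrep theta) sS'S) theta').
Hypotheses (aff : affords L theta') (nDA : A \subset 'N(D)).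
Hypothesis memC : {in A, forall g, conj_aut D g \in C}.
Hypothesis sS' : {in S', forall x, s (coset Z x) \in S'}.
Hypothesis baseP : {in S', forall x, P (conj_aut D x) = L (s (coset Z x))}.
Local Open Scope ring_scope.

(** The pull back along the conjugation action on [D], in a basis that makes it
    agree with the representation chosen in the class [theta]. *)
Lemma proj_repr_pullback :
  exists Pi : gT -> 'M[F]_(Defs.irr_degree (irrep theta)),
  [/\ Pi 1%g = 1%:M, {in A, forall g, Pi g \in unitmx},
      {in A &, forall g h,
        Pi g *m Pi h = proj_cocycle P (conj_aut D g) (conj_aut D h) *: Pi (g * h)%g},
      {in S', forall x, Pi x = irrep theta (s (coset Z x))} &
      forall g h, conj_aut D g = conj_aut D h -> Pi g = Pi h].
Proof.
have sim := mx_rsim_trans aff (mx_rsim_sym res).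
have [T [T' [TT' T'T homT _]]] := mx_rsim_hom sim.
exists (fun g => T' *m P (conj_aut D g) *m T).
case: P memC baseP => Pm a P1 uP _ _ mulP /= mC bP.
split=> [|g Ag|g h Ag Ah|x Sx|g h ->] //.
- by rewrite morph1 P1 mulmx1.
- have uPg := uP _ (mC g Ag).
  suff /mulmx1_unit[] : (T' *m Pm (conj_aut D g) *m T) *m
      (T' *m invmx (Pm (conj_aut D g)) *m T) = 1%:M by [].
  by rewrite !mulmxA -(mulmxA _ T) TT' mulmx1 -(mulmxA T') mulmxV // mulmx1.
- rewrite !mulmxA -(mulmxA _ T) TT' mulmx1.
  rewrite -(mulmxA T' (Pm (conj_aut D g))) mulP ?mC //.
  by rewrite -scalemxAr -scalemxAl morphM ?(subsetP nDA).
by rewrite bP // -mulmxA homT ?sS' // mulmxA T'T mul1mx.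
Qed.

End Pullback.

Section CentralScalar.

Variables (F : closedFieldType) (gT : finGroupType) (Z : {group gT}).
Variable nu : IBr F Z.
Local Open Scope ring_scope.

(** Any diagonal entry would do: the matrix turns out to be scalar. *)
Definition central_value z : F :=
  let k := Ordinal ((mx_irrP _).1 (Defs.irr_reprP (irrep nu))).1 in irrep nu z k k.

(** Schur's lemma, and then comparison with [nu] along the embedding. *)
Lemma central_valueP (X : {group gT}) (sZX : Z \subset X) (i : IBr F X) :
    X \subset 'C(Z) -> i \in IBr_over sZX nu ->
  {in Z, forall z, irrep i z = (central_value z)%:M}.
Proof.
move=> cXZ /IBr_overP[B nzB homB] z Zz; have Xz := subsetP sZX z Zz.
have freeB := repr_hom_row_free (Defs.irr_reprP (irrep nu)) homB nzB.
have /is_scalar_mxP[b iz] : is_scalar_mx (irrep i z).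
  apply: mx_abs_irr_cent_scalar (closed_irr_abs (Defs.irr_reprP (irrep i))) _ _.
  apply/centgmxP=> x Xx; rewrite -!repr_mxM //; congr (irrep i _).
  by rewrite (centsP cXZ x Xx z Zz).
have nuz : irrep nu z = b%:M.
  by apply: (row_free_inj freeB); rewrite homB // /= iz scalar_mxC.
by rewrite iz /central_value nuz mxE eqxx.
Qed.

End CentralScalar.

Section ConjAut.

Variables (F : closedFieldType) (gT : finGroupType) (D S S' : {group gT}).
Variables (theta : IBr F S) (theta' : IBr F S') (sS'S : S' \subset S).
Hypotheses (sS'D : S' \subset D).
Hypotheses (res : affords (subg_repr (irrep theta) sS'S) theta').
Local Open Scope ring_scope.

Lemma conj_aut_fix g : g \in 'N(D) -> g \in 'N(S') ->
    twist_fixes (conjg^~ g^-1%g) theta ->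
  conj_aut D g \in aut_fix theta'.
Proof.
move=> nDg nSg /twist_fixesP[_ _ [B uB homB]].
have [T [T' [TT' T'T homT homT']]] := mx_rsim_hom res.
have actE x : x \in S' -> (conj_aut D g)^-1%g x = (x ^ g^-1)%g.
  by move=> Sx; rewrite -morphV // norm_conj_autE ?groupV ?(subsetP sS'D).
have memJ x : x \in S' -> (x ^ g^-1)%g \in S'.
  by move=> Sx; rewrite memJ_norm ?groupV.
rewrite inE; apply/asboolP/twist_fixesP; split.
- by move=> x y Sx Sy; rewrite !actE ?groupM // conjMg.
- by move=> x Sx; rewrite actE ?memJ.
exists (T' *m B *m T).
  suff /mulmx1_unit[] : (T' *m B *m T) *m (T' *m invmx B *m T) = 1%:M by [].
  by rewrite !mulmxA -(mulmxA _ T) TT' mulmx1 -(mulmxA T') mulmxV // mulmx1.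
move=> x Sx; rewrite actE // !mulmxA homT' ?memJ // -!mulmxA.
rewrite -homT // !mulmxA; congr (_ *m _); rewrite -!mulmxA; congr (_ *m _).
by apply: homB; apply: (subsetP sS'S).
Qed.

End ConjAut.

(** * The theorem *)

Theorem theorem2p5 (F : closedFieldType) (gT : finGroupType)
    (G X Y Z : {group gT})
    (defZ : Z :=: 'Z(X)) (sZY : Z \subset Y) (sYX : Y \subset X)
    (nsXG : X <| G)
    (nu : IBr F Z) (chi : IBr F X) (psi : IBr F Y)
    (chi_nu : chi \in IBr_over (subset_trans sZY sYX) nu)
    (psi_nu : psi \in IBr_over sZY nu)
    (defX : X :=: X^`(1) * Z) (sZZG : Z \subset 'Z(G))
    (stabX : IBr_stab 'N_X(Y) psi = Y)
    (stabN : IBr_stab 'N_G(Y) chi = IBr_stab 'N_G(Y) psi)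
    (stabG : IBr_stab G chi = X * IBr_stab 'N_G(Y) psi)
    (chi' : IBr F (X^`(1))%G) (psi' : IBr F (Y :&: X^`(1))%G)
    (res_chi : affords (subg_repr (irrep chi) (der_sub 1 X)) chi')
    (res_psi : affords (subg_repr (irrep psi) (subsetIl Y X^`(1))) psi')
    (cohom : cohom_cond (Z :&: X^`(1))%G chi' psi') :
  modular_triple_iso (IBr_stab_group G chi) chi
    (IBr_stab_group 'N_G(Y)%G psi) psi
  /\ #|IBr_over (normal_sub nsXG) chi| =
     #|IBr_over (sub_subnorm (subset_trans sYX (normal_sub nsXG))) psi|.
Proof.
set A := IBr_stab_group G chi; set B := IBr_stab_group 'N_G(Y)%G psi.
pose X' := (X^`(1))%G; pose Y' := (Y :&: X')%G; pose Z' := (Z :&: X')%G.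
have sZX := subset_trans sZY sYX; have [sXG nXG] := andP nsXG.
have sZG : Z \subset G := subset_trans sZX sXG.
have cGZ : G \subset 'C(Z) by rewrite centsC (subset_trans sZZG) ?subsetIr.
have AP g : (g \in A) = (g \in G) && `[< twist_fixes (conjg^~ g) chi >].
  rewrite inE in_setI; case: (boolP (g \in G)) => //= Gg.
  by rewrite (subsetP nXG).
have BP b : (b \in B) =
    [&& b \in G, b \in 'N(Y) & `[< twist_fixes (conjg^~ b) psi >]].
  by rewrite inE !in_setI /= -!andbA; case: (b \in 'N(Y)); rewrite ?andbF.
have sAG : A \subset G by apply/subsetP=> g; rewrite AP => /andP[].
have sBG : B \subset G by apply/subsetP=> g; rewrite BP => /and3P[].
have nYB : B \subset 'N(Y) by apply/subsetP=> g; rewrite BP => /and3P[].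
have sBA : B \subset A.
  apply/subsetP=> b Bb; have Gb := subsetP sBG b Bb; rewrite AP Gb /=.
  have : b \in IBr_stab 'N_G(Y) chi by rewrite stabN.
  by rewrite inE => /andP[].
have defA : A :=: X * B by exact: stabG.
have sXA : X \subset A by rewrite defA mulG_subl.
have nsXA : X <| A by rewrite /normal sXA (subset_trans sAG).
have defY : Y :=: X :&: B.
  rewrite -[LHS]stabX; apply/setP=> y; rewrite inE [RHS]in_setI BP !in_setI.
  case Xy: (y \in X) => //=; rewrite (subsetP sXG) //=.
  by case: (y \in 'N(Y)).
have sYB : Y \subset B by rewrite defY subsetIr.
have nsYB : Y <| B by rewrite /normal sYB.
case: cohom => n0 [m0 [P0 [Q0 [s [L [M]]]]]].
case=> -[sP s1] [affL baseP] [affM baseQ] eqc.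
have sX'X : X' \subset X := der_sub 1 X.
have nX'G : G \subset 'N(X') by exact: gFnorm_trans _ nXG.
have nX'A := subset_trans sAG nX'G; have nX'B := subset_trans sBA nX'A.
have cX'Z : X' \subset 'C(Z) := subset_trans (subset_trans sX'X sXG) cGZ.
have nZ'X' : {subset X' <= 'N(Z')}.
  apply/subsetP; apply: subset_trans cX'Z _.
  by rewrite (subset_trans (centS (subsetIl Z X'))) ?cent_sub.
pose c g h := proj_cocycle P0 (conj_aut X' g) (conj_aut X' h).
have memA : {in A, forall g, conj_aut X' g \in Aut X' :&: aut_fix chi'}.
  move=> g Ag; apply/setIP; split; first exact: Aut_aut.
  apply: (conj_aut_fix (subxx X') res_chi); rewrite ?(subsetP nX'A) //.
  by have := groupVr Ag; rewrite AP => /andP[_ /asboolP].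
have memB : {in B, forall b,
    conj_aut X' b \in 'N_(Aut X')(Y' | 'P) :&: aut_fix psi'}.
  move=> b Bb; have nX'b := subsetP nX'B b Bb.
  have nY'b : b \in 'N(Y').
    by rewrite (subsetP (normsI nYB nX'B)).
  apply/setIP; split.
    apply/setIP; split; first exact: Aut_aut.
    apply/astabsP=> y; rewrite /= apermE.
    have [X'y | nX'y] := boolP (y \in X').
      by rewrite norm_conj_autE // memJ_norm.
    by rewrite (out_Aut (Aut_aut _ _)).
  apply: (conj_aut_fix (subsetIr Y X') res_psi nX'b nY'b).
  by have := groupVr Bb; rewrite BP => /and3P[_ _ /asboolP].
have sX' : {in X', forall x, s (coset Z' x) \in X'}.
  by move=> x X'x; have [] := sP (coset Z' x) (mem_quotient _ X'x).
have sZ' : {in X', forall x, exists2 z, z \in Z' & s (coset Z' x) = (z * x)%g}.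
  move=> x X'x; have [X's eq_s] := sP (coset Z' x) (mem_quotient _ X'x).
  move/(rcoset_kercosetP (nZ'X' _ X's) (nZ'X' _ X'x)): eq_s => /rcosetP[z Zz ->].
  by exists z.
have sY' : {in Y', forall y, s (coset Z' y) \in Y'}.
  move=> y Y'y; have /setIP[Yy X'y] := Y'y; have [z Zz ->] := sZ' y X'y.
  by rewrite groupM // inE; have /setIP[Zz1 ->] := Zz; rewrite (subsetP sZY).
have [PiP [PiP1 uPiP mulPiP basePiP extPiP]] :=
  proj_repr_pullback res_chi affL nX'A memA sX' baseP.
have [PiQ [PiQ1 uPiQ mulPiQ basePiQ extPiQ]] :=
  proj_repr_pullback res_psi affM nX'B memB sY' baseQ.
have {}mulPiQ :
    {in B &, forall g h, PiQ g *m PiQ h = c g h *: PiQ (g * h)%g}%R.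
  move=> g h Bg Bh; rewrite mulPiQ //; congr (_ *: _)%R; symmetry.
  by apply: eqc; rewrite inE ?memB ?memA ?(subsetP sBA).
(* [xp x] is the component of [x] in [X'], up to [Z']; it lies in [Y] when [x]
   does, which makes the scalars [mu] the same for [chi] and [psi]. *)
pose xp x := repr (X' :&: x *: Z).
have xpP x : x \in X -> xp x \in X' /\ exists2 z, z \in Z & xp x = (x * z)%g.
  rewrite {1}defX => /mulsgP[x' z X'x' Zz def_x].
  have /setIP[X'xp /lcosetP[z' Zz' eq_xp]] : xp x \in X' :&: x *: Z.
    apply: (mem_repr x'); rewrite inE X'x' def_x.
    by apply/lcosetP; exists z^-1%g; rewrite ?groupV // mulgK.
  by split=> //; exists z'.
pose mu x := central_value nu (x^-1 * s (coset Z' (xp x)))%g.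
have base (S : {group gT}) (sZS : Z \subset S) (sSX : S \subset X)
    (theta : IBr F S) (Pi : gT -> 'M[F]_(Defs.irr_degree (irrep theta))) :
    theta \in IBr_over sZS nu ->
    {in S :&: X', forall x, Pi x = irrep theta (s (coset Z' x))} ->
    (forall g h, conj_aut X' g = conj_aut X' h -> Pi g = Pi h) ->
  {in S, forall x, Pi x = (mu x *: irrep theta x)%R}.
  move=> over_theta basePi extPi x Sx; have Xx := subsetP sSX x Sx.
  have [X'xp [z Zz def_xp]] := xpP x Xx.
  have [Gx Gz] := (subsetP sXG x Xx, subsetP sZG z Zz).
  have conj_z : conj_aut X' z = 1%g.
    by apply: mker; rewrite ker_conj_aut (subsetP _ z Zz) // centsC.
  have -> : Pi x = Pi (xp x).
    by apply: extPi; rewrite def_xp conj_aut_morphM ?(subsetP nX'G) // conj_z mulg1.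
  have [z' /setIP[Zz' _] def_s] := sZ' _ X'xp.
  have Zzeta : (x^-1 * s (coset Z' (xp x)))%g \in Z.
    by rewrite def_s def_xp mulgA (centsP cGZ (x^-1)%g _ z' Zz') ?groupV //
      -mulgA mulKg groupM.
  rewrite basePi; last first.
    rewrite inE X'xp andbT def_xp groupM // (subsetP sZS) //.
  rewrite -[s _](mulKVg x) repr_mxM ?(subsetP sZS _ Zzeta) //.
  have cSZ := subset_trans (subset_trans sSX sXG) cGZ.
  by rewrite (central_valueP cSZ over_theta Zzeta) mul_mx_scalar.
(* One transversal for [A / X] and for [B / Y]; as [X] meets [B] in a group, the
   representative of the trivial coset is 1. *)
pose t g := repr ((X :* g) :&: B).
have tP g : g \in A -> [/\ t g \in A, t g \in B & (g * (t g)^-1)%g \in X].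
  rewrite {1}defA => /mulsgP[x b Xx Bb def_g].
  have /setIP[/rcosetP[y Xy def_t] Bt] : t g \in (X :* g) :&: B.
    apply: (mem_repr b); rewrite inE Bb andbT.
    by apply/rcosetP; exists x^-1%g; rewrite ?groupV // def_g mulKg.
  rewrite (subsetP sBA) //; split=> //.
  by rewrite def_t invMg mulgA mulgV mul1g groupV.
have tX : {in X & A, forall x g, t (x * g)%g = t g}.
  by move=> x g Xx _; rewrite /t rcosetM (rcoset_id Xx).
have t1 : t 1%g = 1%g by rewrite /t mulg1 -defY repr_group.
have plP : proj_lift A (irrep chi) PiP c mu.
  split=> //; first exact: Defs.irr_reprP.
  by apply: (base X _ (subxx X) _ _ chi_nu) => // x /setIP[_]; apply: basePiP.
have plQ : proj_lift B (irrep psi) PiQ c mu.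
  by split=> //; [exact: Defs.irr_reprP | apply: (base Y sZY sYX)].
(* As [PiP] and [PiQ] share [c] and [mu], this is used for both. *)
have twist1 : {in A & X, forall g x, twist_scalar c mu g x = 1%R}.
  apply: (twist_scalar_trivial plP defX); first exact: subset_trans sAG cGZ.
  move=> z Zz.
  rewrite (central_valueP (subset_trans sXG cGZ) chi_nu) //.
  exact: scalar_mx_is_scalar.
have peP : proj_ext A (irrep chi) (renorm (irrep chi) PiP t)
    (renorm_cocycle c mu t).
  by apply: (renorm_proj_ext plP) => // g /tP[].
have peQ : proj_ext B (irrep psi) (renorm (irrep psi) PiQ t)
    (renorm_cocycle c mu t).
  apply: (renorm_proj_ext plQ) => //.
  - by move=> b y Bb Yy; apply: twist1; rewrite ?(subsetP sBA) ?(subsetP sYX).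
  - move=> b Bb; have [_ Bt Xbt] := tP b (subsetP sBA b Bb).
    by split=> //; rewrite defY inE Xbt groupM ?groupV.
  by move=> y b Yy Bb; apply: tX; rewrite ?(subsetP sBA) ?(subsetP sYX).
have tripleA : modular_triple A chi.
  split=> //; apply/setP=> g; rewrite inE in_setI AP.
  case Gg: (g \in G) => //=; rewrite (subsetP nXG) //=.
  by case: `[< _ >].
have tripleB : modular_triple B psi.
  split=> //; apply/setP=> b; rewrite inE in_setI BP.
  by case: (b \in G); case: (b \in 'N(Y)); case: `[< _ >].
have iso := proj_ext_triple_iso peP peQ sBA defA defY tripleA tripleB.
split=> //; rewrite -Clifford_correspondence.
rewrite (modular_triple_iso_card _ sYB iso).
have nsYN : Y <| 'N_G(Y) by rewrite normalSG ?(subset_trans sYX).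
rewrite (bool_irrelevance (sub_subnorm _) (normal_sub nsYN)).
rewrite -(Clifford_correspondence nsYN psi).
by rewrite (bool_irrelevance sYB (stab_normal nsYN psi)).
Qed.
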